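(* Assume the standing setting and hypotheses (H1), (H2), (H3) below, let $p\in[1,+\infty]$, and equip $X$ and $Y$ with $\|\cdot\|_p$. The following are equivalent: (i) the system given by (P) with state space $X$ is ISS w.r.t. inputs in $\mathcal{U}$, i.e. there are $\beta\in\mathcal{KL}$, $\gamma\in\mathcal{K}$ with $\|\phi(t,x,u)\|_p\le\beta(\|x\|_p,t)+\gamma(\|u\|_{\mathcal{U}})$ for all $t\ge0$, $x\in X$, $u\in\mathcal{U}(x)$; (ii) the same estimate holds for all $t\ge0$, $x\in X$ and all $u\in\mathcal{U}(x)\cap\mathcal{U}_c$ (inputs constant in time and space); (iii) the system (Q) with state space $Y$ is ISS w.r.t. inputs in $\mathcal{V}$, i.e. there are $\beta\in\mathcal{KL}$, $\gamma\in\mathcal{K}$ with $\|\phi_Y(t,y,v)\|_p\le\beta(\|y\|_p,t)+\gamma(\|v\|_{\mathcal{V}})$ for all $t\ge0$, $y\in Y$, $v\in\mathcal{V}$.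
   Context: Standing setting: $G\subset\mathbb{R}^n$ open and bounded, $\mu(G)$ its Lebesgue measure; $CL=C^0(\mathbb{R}_+\times\overline G)\cap C^{1,2}((0,\infty)\times G)$; $x[t]:=x(t,\cdot)$. $L$: $(Lx)(t,z)=\partial_tx-\sum_{i,j=1}^na_{ij}(z)\partial_{z_i}\partial_{z_j}x-f(z,x,\nabla x)$, $a_{ij}\in C^0(\overline G)$, $f\in C^0(\overline G\times\mathbb{R}\times\mathbb{R}^n)$, uniformly parabolic ($\sum a_{ij}(z)\xi_i\xi_j\ge K|\xi|^2$, $K>0$). Problem (P): $Lx=0$ on $(0,\infty)\times G$, $x(0,\cdot)=x_0$ on $G$, $x=u$ on $\mathbb{R}_+\times\partial G$. $\mathcal{U}=\{u\in C^0(\mathbb{R}_+;C^0(\partial G)):u\text{ bounded}\}$, $\|u\|_{\mathcal{U}}=\sup_{t\ge0,z\in\partial G}|u(t,z)|$, ordered pointwise; $\mathcal{U}_c=\{u\in\mathcal{U}:\exists k\in\mathbb{R},\ u\equiv k\}$. $\phi(t,x_0,u)=x[t]$ denotes the unique classical solution of (P). (H1) There is a linear space $X\subseteq C^0(\overline G)$ containing all constant functions, and for each $x_0\in X$ a nonempty set $\mathcal{U}(x_0)\subseteq\{v\in\mathcal{U}:v(0,z)=x_0(z)\ \forall z\in\partial G\}$ containing every $v\in\mathcal{U}$ with $v(t,z)=x_0(z)$ for all $z\in\partial G$, $t\ge0$, such that for every $x_0\in X$, $u\in\mathcal{U}(x_0)$ problem (P) has a solution $x\in CL$ with $x[t]\in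 X$ for all $t\ge0$. (H2) For every bounded $W\subset\mathbb{R}$ there is $k>0$ with $f(z,w_1,\xi)-f(z,w_2,\xi)<k(w_1-w_2)$ for all $w_1>w_2$ in $W$, $z\in G$, $\xi\in\mathbb{R}^n$; and $f$ is continuously differentiable w.r.t. $(w,\xi)$. (H3) For every $\delta>0$, $a\in\mathbb{R}$, $x\in X$ there is a continuous $k:\overline G\to[0,1]$ with $k=1$ on $\partial G$, $k(z)=0$ whenever $z\in G$ and $\inf_{s\in\partial G}|z-s|\ge\delta$, and $(1-k)x+ak\in X$. System (Q): $\partial_ty-\sum a_{ij}(z)\partial_{z_i}\partial_{z_j}y-f(z,y+v,\nabla y)=0$ on $(0,\infty)\times G$, $y=0$ on $\mathbb{R}_+\times\partial G$, with state space $Y=\{y\in X:y=0\text{ on }\partial G\}$ and inputs $\mathcal{V}=\{v\in C^0(\mathbb{R}_+\times\overline G):v\equiv k\text{ for some }k\in\mathbb{R}\}$, $\|v\|_{\mathcal{V}}=|k|$ (sup norm). Its solution is $\phi_Y(t,y,v)=\phi(t,y+v,v|_{\partial G})-v$ (well defined since $v|_{\partial G}\in\mathcal{U}(y+v)$ by (H1)). $\mathcal{K},\mathcal{KL}$ are the standard comparison function classes. *)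

(* Defs.v *)
(* Setting of the paper: G ⊂ R^n open bounded, points z ∈ R^n are row vectors 'rV[R]_n,
   R : realType.  Functions on [0,∞) × Ḡ are represented as x : R -> 'rV[R]_n -> R
   (x t z = x(t,z)); only their values on the relevant domains matter. *)
From mathcomp Require Import all_boot all_order all_algebra.
From mathcomp Require Import all_classical all_reals all_analysis.
Import Order.TTheory GRing.Theory Num.Theory.
Import numFieldNormedType.Exports.

Set Implicit Arguments.
Unset Strict Implicit.
Unset Printing Implicit Defensive.

Local Open Scope classical_set_scope.
Local Open Scope ring_scope.

Section Setting.
Context {R : realType} {n : nat}.
Implicit Types (G : set 'rV[R]_n).

Definition ev (i : 'I_n) : 'rV[R]_n := delta_mx 0 i.

Definition euclid (v : 'rV[R]_n) : R := Num.sqrt (\sum_(i < n) v 0 i ^+ 2).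

Definition bdry G : set 'rV[R]_n := closure G `\` G.

Definition classK (g : R -> R) : Prop :=
  [/\ {within [set r | 0 <= r], continuous g}, g 0 = 0 &
      forall r s, 0 <= r -> r < s -> g r < g s].

Definition classKL (b : R -> R -> R) : Prop :=
  [/\ {within [set q : R * R | 0 <= q.1 /\ 0 <= q.2], continuous (fun q => b q.1 q.2)},
      (forall t, 0 <= t -> classK (fun r => b r t)),
      (forall r, 0 <= r -> forall t s, 0 <= t -> t <= s -> b r s <= b r t) &
      (forall r, 0 <= r -> b r t @[t --> +oo] --> 0)].

Definition upd (z : 'rV[R]_n) (k : nat) (t : R) : 'rV[R]_n :=
  \row_(j < n) (if (j : nat) == k then t else z 0 j).

(* iterated Lebesgue integral over the first k coordinates (Tonelli);
   iint n F 0 = ∫_{R^n} F dz for F >= 0 Borel *)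
Fixpoint iint (k : nat) (F : 'rV[R]_n -> \bar R) (z : 'rV[R]_n) : \bar R :=
  match k with
  | 0 => F z
  | k'.+1 => (\int[lebesgue_measure]_t iint k' F (upd z k' t))%E
  end.

Definition Lpnorm G (p : \bar R) (g : 'rV[R]_n -> R) : R :=
  match p with
  | r%:E => (fine (iint n (fun z => if `[< G z >] then (`|g z| `^ r)%:E else 0%E) 0))
              `^ r^-1
  | +oo%E => sup [set `|g z| | z in G]
  | -oo%E => 0
  end.

Definition dt (x : R -> 'rV[R]_n -> R) (t : R) (z : 'rV[R]_n) : R :=
  'D_1 (fun s => x s z) t.
Definition dz (i : 'I_n) (x : R -> 'rV[R]_n -> R) (t : R) (z : 'rV[R]_n) : R :=
  'D_(ev i) (x t) z.
Definition d2 (i j : 'I_n) (x : R -> 'rV[R]_n -> R) (t : R) (z : 'rV[R]_n) : R :=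
  'D_(ev i) (fun w => 'D_(ev j) (x t) w) z.
Definition grad (x : R -> 'rV[R]_n -> R) (t : R) (z : 'rV[R]_n) : 'rV[R]_n :=
  \row_(i < n) dz i x t z.

Definition CL G (x : R -> 'rV[R]_n -> R) : Prop :=
  let Om := [set q : R * 'rV[R]_n | 0 < q.1 /\ G q.2] in
  [/\ {within [set q : R * 'rV[R]_n | 0 <= q.1 /\ closure G q.2],
         continuous (fun q => x q.1 q.2)},
      (forall t z, 0 < t -> G z ->
         derivable (fun s => x s z) t 1 /\
         forall i, derivable (x t) z (ev i) /\
                   forall j, derivable (fun w => 'D_(ev j) (x t) w) z (ev i)),
      {within Om, continuous (fun q => dt x q.1 q.2)},
      (forall i, {within Om, continuous (fun q => dz i x q.1 q.2)}) &
      (forall i j, {within Om, continuous (fun q => d2 i j x q.1 q.2)})].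

Definition Lop (a : 'I_n -> 'I_n -> 'rV[R]_n -> R) (f : 'rV[R]_n -> R -> 'rV[R]_n -> R)
  (x : R -> 'rV[R]_n -> R) (t : R) (z : 'rV[R]_n) : R :=
  dt x t z - \sum_(i < n) \sum_(j < n) a i j z * d2 i j x t z - f z (x t z) (grad x t z).

Definition isSolP G a f (x0 : 'rV[R]_n -> R) (u : R -> 'rV[R]_n -> R)
  (x : R -> 'rV[R]_n -> R) : Prop :=
  [/\ CL G x,
      (forall t z, 0 < t -> G z -> Lop a f x t z = 0),
      (forall z, G z -> x 0 z = x0 z) &
      (forall t z, 0 <= t -> bdry G z -> x t z = u t z)].

(* 𝒰: bounded, continuous R_+ -> C^0(∂G) (sup-norm topology on C^0(∂G)) *)
Definition inU G (u : R -> 'rV[R]_n -> R) : Prop :=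
  [/\ (forall t, 0 <= t -> {within bdry G, continuous (u t)}),
      (forall t, 0 <= t -> forall e, 0 < e -> exists2 d, 0 < d &
         forall s, 0 <= s -> `|s - t| < d ->
           forall z, bdry G z -> `|u s z - u t z| < e) &
      (exists M, forall t z, 0 <= t -> bdry G z -> `|u t z| <= M)].

Definition normU G (u : R -> 'rV[R]_n -> R) : R :=
  sup [set `|u q.1 q.2| | q in [set q : R * 'rV[R]_n | 0 <= q.1 /\ bdry G q.2]].

Definition constU G (u : R -> 'rV[R]_n -> R) : Prop :=
  exists k : R, forall t z, 0 <= t -> bdry G z -> u t z = k.

Definition standing G (a : 'I_n -> 'I_n -> 'rV[R]_n -> R)
  (f : 'rV[R]_n -> R -> 'rV[R]_n -> R) : Prop :=
  [/\ open G, bounded_set G,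
      (forall i j, {within closure G, continuous (a i j)}),
      (exists2 K, 0 < K & forall z xi, closure G z ->
         \sum_(i < n) \sum_(j < n) a i j z * xi 0 i * xi 0 j >= K * euclid xi ^+ 2) &
      {within [set q : 'rV[R]_n * R * 'rV[R]_n | closure G q.1.1],
         continuous (fun q => f q.1.1 q.1.2 q.2)}].

Definition linspaceX G (X : set ('rV[R]_n -> R)) : Prop :=
  [/\ (forall x, X x -> {within closure G, continuous x}),
      (forall c : R, X (fun _ => c)),
      (forall x y, X x -> X y -> X (fun z => x z + y z)) &
      (forall (c : R) x, X x -> X (fun z => c * x z))].

Definition H1 G a f (X : set ('rV[R]_n -> R))
  (Uset : ('rV[R]_n -> R) -> set (R -> 'rV[R]_n -> R)) : Prop :=
  linspaceX G X /\
  forall x0, X x0 ->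
    [/\ Uset x0 !=set0,
        (forall v, Uset x0 v -> inU G v /\ forall z, bdry G z -> v 0 z = x0 z),
        (forall v, inU G v -> (forall t z, 0 <= t -> bdry G z -> v t z = x0 z) ->
                   Uset x0 v) &
        (forall u, Uset x0 u -> exists x, isSolP G a f x0 u x /\
                                          forall t, 0 <= t -> X (x t))].

Definition H2 G (f : 'rV[R]_n -> R -> 'rV[R]_n -> R) : Prop :=
  (forall W : set R, bounded_set W -> exists2 k, 0 < k &
     forall w1 w2 z xi, W w1 -> W w2 -> w2 < w1 -> G z ->
       f z w1 xi - f z w2 xi < k * (w1 - w2)) /\
  [/\ (forall z w xi, closure G z ->
         derivable (fun w' => f z w' xi) w 1 /\ forall i, derivable (f z w) xi (ev i)),
      {within [set q : 'rV[R]_n * R * 'rV[R]_n | closure G q.1.1],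
         continuous (fun q => 'D_1 (fun w' => f q.1.1 w' q.2) q.1.2)} &
      (forall i, {within [set q : 'rV[R]_n * R * 'rV[R]_n | closure G q.1.1],
         continuous (fun q => 'D_(ev i) (f q.1.1 q.1.2) q.2)})].

Definition H3 G (X : set ('rV[R]_n -> R)) : Prop :=
  forall (delta : R) (c : R) x, 0 < delta -> X x ->
    exists k : 'rV[R]_n -> R,
      [/\ {within closure G, continuous k},
          (forall z, closure G z -> 0 <= k z <= 1),
          (forall z, bdry G z -> k z = 1),
          (* inf_{s ∈ ∂G} |z - s| >= δ, written out *)
          (forall z, G z -> (forall s, bdry G s -> delta <= euclid (z - s)) -> k z = 0) &
          X (fun z => (1 - k z) * x z + c * k z)].

(* uniqueness of classical solutions of (P), asserted in the standing setting
   ("φ(t,x0,u) denotes the unique classical solution of (P)") *)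
Definition uniqueP G a f (X : set ('rV[R]_n -> R))
  (Uset : ('rV[R]_n -> R) -> set (R -> 'rV[R]_n -> R)) : Prop :=
  forall x0 u x1 x2, X x0 -> Uset x0 u -> isSolP G a f x0 u x1 -> isSolP G a f x0 u x2 ->
    forall t z, 0 <= t -> closure G z -> x1 t z = x2 t z.

(* (i) ISS of (P) on X w.r.t. inputs in 𝒰; φ(t,x0,u) = x t for the solution x *)
Definition ISS_P G a f (X : set ('rV[R]_n -> R))
  (Uset : ('rV[R]_n -> R) -> set (R -> 'rV[R]_n -> R)) (p : \bar R) : Prop :=
  exists beta gamma, classKL beta /\ classK gamma /\
    forall x0 u x t, X x0 -> Uset x0 u -> isSolP G a f x0 u x -> 0 <= t ->
      Lpnorm G p (x t) <= beta (Lpnorm G p x0) t + gamma (normU G u).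

Definition ISS_P_const G a f (X : set ('rV[R]_n -> R))
  (Uset : ('rV[R]_n -> R) -> set (R -> 'rV[R]_n -> R)) (p : \bar R) : Prop :=
  exists beta gamma, classKL beta /\ classK gamma /\
    forall x0 u x t, X x0 -> Uset x0 u -> constU G u -> isSolP G a f x0 u x -> 0 <= t ->
      Lpnorm G p (x t) <= beta (Lpnorm G p x0) t + gamma (normU G u).

(* (iii) ISS of (Q) on Y = {y ∈ X : y = 0 on ∂G} w.r.t. inputs v ≡ k in 𝒱,
   ||v||_𝒱 = |k|, with φ_Y(t,y,v) = φ(t, y+v, v|∂G) - v *)
Definition ISS_Q G a f (X : set ('rV[R]_n -> R)) (p : \bar R) : Prop :=
  exists beta gamma, classKL beta /\ classK gamma /\
    forall (y : 'rV[R]_n -> R) (k : R) x t,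
      X y -> (forall z, bdry G z -> y z = 0) ->
      isSolP G a f (fun z => y z + k) (fun _ _ => k) x -> 0 <= t ->
      Lpnorm G p (fun z => x t z - k) <= beta (Lpnorm G p y) t + gamma `|k|.

End Setting.

(* Main.v *)
(** ISS for constant inputs implies ISS for all inputs by monotonicity.  If
    [|u| < c], hypothesis (H3) deforms the initial state [x0] near the boundary of
    [G] into states with boundary values [c] and [-c] lying above and below [x0];
    by the parabolic comparison principle the corresponding solutions with
    constant inputs enclose the given one, and [c] is let tend to [||u||].
    Constant inputs [k] are exchanged for the system (Q) by subtracting [k].

    The comparison principle is the classical maximum argument: at a positive
    maximum of [exp (- k t) (x1 - x2)] the gradients agree and the elliptic term is
    [<= 0], which contradicts the one-sided Lipschitz bound of (H2).

    The iterated integral defining the [L^p] norm is handled through lower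
    semicontinuity: [|g|^r] extended by [0] outside the open set [G] is lower
    semicontinuous and nonnegative, a class preserved by integrating out one
    coordinate (Fatou); this provides all the measurability that is needed. *)
Require Import Defs.
From mathcomp Require Import all_boot all_order all_algebra.
From mathcomp Require Import all_classical all_reals all_analysis.
From mathcomp Require Import measurable_realfun ring lra.
Import Order.TTheory GRing.Theory Num.Theory.
Import numFieldNormedType.Exports.
Local Open Scope classical_set_scope.
Local Open Scope ring_scope.
Set Implicit Arguments.
Unset Strict Implicit.
Unset Printing Implicit Defensive.

(** * Linear algebra *)

(** Prepares the elimination of one coordinate: moving [x] along a basis vector produces two cross
    terms, which the symmetry of [S] merges. *)
Lemma quad_sub_delta (R : comNzRingType) n (S : 'M[R]_n) (x : 'rV[R]_n) k (t : R) :
  S^T = S ->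
  let e := delta_mx 0 k in
  (x - t *: e) *m S *m (x - t *: e)^T =
  x *m S *m x^T - (t *+ 2) *: (row k S *m x^T) + (t ^+ 2) *: (S k k)%:M.
Proof.
move=> St e.
have eS : e *m S = row k S by rewrite -rowE.
have Se : S *m e^T = (row k S)^T by rewrite -eS trmx_mul St.
have xs : x *m (row k S)^T = row k S *m x^T.
  rewrite -[LHS](trmxK) trmx_mul trmxK.
  by apply/matrixP => i j; rewrite !mxE !ord1.
have ss : e *m (row k S)^T = (S k k)%:M.
  by rewrite -rowE; apply/matrixP => i j; rewrite !mxE !ord1 eqxx mulr1n.
have -> : (x - t *: e)^T = x^T - t *: e^T by apply/matrixP => i j; rewrite !mxE.
rewrite !mulmxBl !mulmxBr -!scalemxAl -!scalemxAr.
rewrite -[x *m S *m e^T]mulmxA -[e *m S *m e^T]mulmxA Se xs eS ss scalerA.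
apply/matrixP => i j; rewrite !mxE; ring.
Qed.

(* Symmetric elimination: a nonzero pivot splits off a rank-one term
   [s^T s / d], whose pairing with [H] is a value of the quadratic form of [H]. *)
Lemma trace_psd_nsd (R : realFieldType) n (S H : 'M[R]_n) :
  S^T = S ->
  (forall x : 'rV_n, 0 <= (x *m S *m x^T) 0 0) ->
  (forall x : 'rV_n, (x *m H *m x^T) 0 0 <= 0) ->
  \tr (S *m H) <= 0.
Proof.
move=> St Sp Hn.
(* Induction on the number [m] of rows still to be eliminated; the first [k] rows of [S] are already
   zero. *)
suff main m : forall k, (k + m = n)%N -> forall S : 'M[R]_n, S^T = S ->
    (forall x : 'rV_n, 0 <= (x *m S *m x^T) 0 0) ->
    (forall i j : 'I_n, (i < k)%N -> S i j = 0) -> \tr (S *m H) <= 0.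
  by apply: (main n 0%N) => //.
move: S St Sp => _ _ _; elim: m => [|m IH] k kmn S St Sp S0.
  suff -> : S = 0 by rewrite mul0mx linear0.
  by apply/matrixP => i j; rewrite S0 ?mxE// -(addn0 k) kmn.
have kn : (k < n)%N by rewrite -kmn addnS ltnS leq_addr.
pose ko := Ordinal kn.
have Ssym i j : S i j = S j i by rewrite -{1}St mxE.
pose d : R := S ko ko; pose s := row ko S; pose e : 'rV[R]_n := delta_mx 0 ko.
have Q (x : 'rV[R]_n) t : ((x - t *: e) *m S *m (x - t *: e)^T) 0 0 =
    (x *m S *m x^T) 0 0 - t *+ 2 * (s *m x^T) 0 0 + t ^+ 2 * d.
  by rewrite quad_sub_delta// [LHS]mxE [X in X + _]mxE /= !mxE eqxx mulr1n.
have d0 : 0 <= d.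
  by have := Sp (0 - 1 *: e); rewrite Q !mul0mx trmx0 mulmx0 !mxE; lra.
(* A zero pivot makes the form affine in [t], so nonnegativity for all [t] forces row [ko] to
   vanish. *)
have [dz|dn0] := eqVneq d 0.
  have sz : forall j, S ko j = 0.
    move=> j; pose x : 'rV[R]_n := delta_mx 0 j.
    have sx : (s *m x^T) 0 0 = S ko j.
      rewrite trmx_delta -colE !mxE //.
    set q := (x *m S *m x^T) 0 0.
    have P t : 0 <= q - t *+ 2 * S ko j by have := Sp (x - t *: e); rewrite Q sx dz mulr0 addr0.
    apply/eqP; apply/negPn/negP => nz.
    (* At this [t] the affine function takes the value [-1]. *)
    have := P ((q + 1) / (S ko j *+ 2)).
    rewrite -[_ *+ 2]mulr_natl [X in _ * X * _](_ : _ = (q + 1) / (S ko j) / 2); last first.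
      by rewrite -[_ *+ 2]mulr_natl; field; rewrite nz.
    rewrite (_ : q - _ = -1); first lra.
    by field.
  apply: (IH k.+1) => //; first by rewrite addSnnS.
  move=> i j; rewrite ltnS leq_eqVlt => /orP[/eqP ik|]; last exact: S0.
  by rewrite (_ : i = ko) ?sz//; exact/val_inj.
pose S' := S - d^-1 *: (s^T *m s).
have -> : S = S' + d^-1 *: (s^T *m s) by rewrite subrK.
rewrite mulmxDl linearD /= -scalemxAl linearZ /= -mulmxA.
rewrite [X in _ + _ * X <= _]mxtrace_mulC.
have dp : 0 < d by rewrite lt_def dn0.
have t1 : \tr (s *m H *m s^T) <= 0 by rewrite trace_mx11; exact: Hn.
suff : \tr (S' *m H) <= 0.
  by have : d^-1 * \tr (s *m H *m s^T) <= 0 by [rewrite pmulr_rle0 // invr_gt0]; lra.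
apply: (IH k.+1); first by rewrite addSnnS.
- by rewrite /S' linearB /= linearZ /= trmx_mul trmxK St.
(* This multiple of [e] minimises the form over [t]; the minimum is the value at [x] of the form of
   [S']. *)
- move=> x; have := Sp (x - ((s *m x^T) 0 0 / d) *: e); rewrite Q.
  rewrite /S' mulmxBr mulmxBl -scalemxAr -scalemxAl.
  have -> : x *m (s^T *m s) *m x^T = (s *m x^T)^T *m (s *m x^T).
    by rewrite trmx_mul trmxK !mulmxA.
  set w := s *m x^T.
  have -> : (x *m S *m x^T - d^-1 *: (w^T *m w)) 0 0 =
      (x *m S *m x^T) 0 0 - d^-1 * (w 0 0 * w 0 0).
    by move: (x *m S *m x^T) w => M w; rewrite !mxE big_ord1 mxE.
  congr (_ <= _); set u := (x *m S *m x^T) 0 0; set v := w 0 0.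
  by rewrite -mulr_natl; field.
- move=> i j; rewrite ltnS leq_eqVlt => /orP[/eqP ik|ik].
    rewrite (_ : i = ko); last exact/val_inj.
    by rewrite !mxE big_ord1 !mxE -/d mulrA mulVf// mul1r subrr.
  by rewrite !mxE big_ord1 !mxE (S0 i j)// (Ssym ko i) (S0 i ko)// mul0r mulr0 subr0.
Qed.

(** A symmetric [H] pairs only with the symmetric part of [A], so [A + A^T] can replace [A] at the
    cost of doubling the trace. *)
Lemma trace_sym_le0 (R : realFieldType) n (A H : 'M[R]_n) :
  H^T = H ->
  (forall x : 'rV_n, 0 <= (x *m A *m x^T) 0 0) ->
  (forall x : 'rV_n, (x *m H *m x^T) 0 0 <= 0) ->
  \sum_i \sum_j A i j * H i j <= 0.
Proof.
move=> Ht Ap Hn.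
have -> : \sum_i \sum_j A i j * H i j = \tr (A *m H).
  apply: eq_bigr => i _; rewrite mxE; apply: eq_bigr => j _.
  by rewrite -{1}Ht mxE.
suff : \tr ((A + A^T) *m H) <= 0.
  rewrite mulmxDl linearD /=.
  have -> : \tr (A^T *m H) = \tr (A *m H).
    by rewrite -mxtrace_tr trmx_mul trmxK Ht mxtrace_mulC.
  lra.
apply: trace_psd_nsd => //.
  by rewrite linearD /= trmxK addrC.
move=> x; rewrite mulmxDr mulmxDl mxE addr_ge0//.
have := Ap x; congr (_ <= _).
by rewrite -[in LHS](trmxK (x *m A *m x^T)) [LHS]mxE !trmx_mul trmxK mulmxA.
Qed.

(** * Second derivatives *)

Section Calculus.
Context {R : realType} {V : normedModType R}.
Implicit Types (g : V -> R) (z v w : V).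

Lemma is_derive_line g z v (r : R) : derivable g (z + r *: v) v ->
  is_derive r 1 (fun s : R => g (z + s *: v)) ('D_v g (z + r *: v)).
Proof.
move=> dg.
have E : (fun h : R => h^-1 *: (((fun s : R => g (z + s *: v)) \o shift r) (h *: 1)
            - g (z + r *: v))) =
         (fun h : R => h^-1 *: ((g \o shift (z + r *: v)) (h *: v) - g (z + r *: v))).
  apply/funext => h /=; congr (_ *: (g _ - _)).
  by rewrite [h *: 1]mulr1 scalerDl addrCA addrC.
apply: DeriveDef; first by rewrite /derivable E.
by rewrite /derive E.
Qed.

(** The parameter runs over [[0, 1]] and is scaled by [s], so that increments of either sign are
    covered. *)
Lemma MVT_line g z v (s : R) :
  (forall r : R, 0 <= r <= 1 -> derivable g (z + (r * s) *: v) v) ->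
  exists2 c : R, 0 < c < 1 & g (z + s *: v) - g z = s * 'D_v g (z + (c * s) *: v).
Proof.
move=> dg.
pose phi (r : R) := g (z + (r * s) *: v).
have dphi (r : R) : 0 <= r <= 1 -> is_derive r 1 phi (s * 'D_v g (z + (r * s) *: v)).
  move=> /dg dr.
  have -> : phi = (fun t => g (z + t *: v)) \o (fun r => r * s) by [].
  have d1 : is_derive (r * s) 1 (fun t : R => g (z + t *: v)) ('D_v g (z + (r * s) *: v)).
    exact: is_derive_line.
  have d2 : is_derive r 1 (fun r : R => r * s) s.
    have := @is_deriveM R R id (cst s) r 1 1 0 (is_derive_id _ _) (is_derive_cst _ _ _).
    by rewrite scaler0 add0r [_ *: _]mulr1.
  rewrite mulrC; exact: is_derive1_comp.
have [||c cin] := @MVT R phi (fun r => s * 'D_v g (z + (r * s) *: v)) 0 1 ltr01.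
- by move=> r; rewrite in_itv /= => /andP[/ltW r0 /ltW r1]; apply: dphi; rewrite r0.
- apply: derivable_within_continuous => r; rewrite in_itv /= => r01.
  by case: (dphi r r01).
rewrite /phi mul1r mul0r scale0r addr0 subr0 mulr1 => E.
by exists c; [move: cin; rewrite in_itv|].
Qed.

(** Two mean value theorems: for the increment [h y = g (y + s *: w) - g y] along [v], then for
    ['D_v g] along [w]. The bound on [s] keeps all points in the ball. *)
Lemma second_difference g z v w (s r : R) :
  0 < s -> s * (`|v| + `|w|) < r ->
  (forall y, `|y - z| < r -> derivable g y v) ->
  (forall y, `|y - z| < r -> derivable ('D_v g) y w) ->
  exists2 y, `|y - z| < r &
  g (z + s *: v + s *: w) - g (z + s *: v) - (g (z + s *: w) - g z) =
  s * s * 'D_w ('D_v g) y.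
Proof.
move=> s0 sr dv dw.
have vw (a b : R) : 0 <= a <= 1 -> 0 <= b <= 1 ->
    `|z + (a * s) *: v + (b * s) *: w - z| < r.
  move=> a01 b01; rewrite addrC -addrA addKr.
  apply: le_lt_trans (ler_normD _ _) _; apply: le_lt_trans sr.
  move: a01 b01 => /andP[a0 a1] /andP[b0 b1].
  rewrite mulrDr lerD// normrZ ger0_norm ?mulr_ge0 ?(ltW s0)//.
    by rewrite -mulrA ler_piMl// mulr_ge0// ltW.
  by rewrite -mulrA ler_piMl// mulr_ge0// ltW.
pose h y := g (y + s *: w) - g y.
have dh (c : R) : 0 <= c <= 1 -> is_derive (z + (c * s) *: v) v h
    ('D_v g (z + (c * s) *: v + s *: w) - 'D_v g (z + (c * s) *: v)).
  move=> c01.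
  have i1 : is_derive (z + (c * s) *: v) v g ('D_v g (z + (c * s) *: v)).
    apply/derivableP; apply: dv.
    by have := @vw c 0 c01; rewrite mul0r scale0r addr0; apply; rewrite lexx ler01.
  have i2 : is_derive (z + (c * s) *: v) v (fun y => g (y + s *: w))
      ('D_v g (z + (c * s) *: v + s *: w)).
    have /derivableP d : derivable g (z + (c * s) *: v + s *: w) v.
      by apply: dv; have := @vw c 1 c01; rewrite mul1r; apply; rewrite lexx ler01.
    have E : (fun t : R => t^-1 *: (((fun y => g (y + s *: w)) \o shift (z + (c * s) *: v)) (t *: v)
            - g (z + (c * s) *: v + s *: w))) =
         (fun t : R => t^-1 *: ((g \o shift (z + (c * s) *: v + s *: w)) (t *: v)
            - g (z + (c * s) *: v + s *: w))).
      by apply/funext => t /=; rewrite !addrA.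
    apply: DeriveDef; first by rewrite /derivable E; by case: d.
    by rewrite /derive E.
  exact: is_deriveB.
have [c cc hE] := @MVT_line h z v s (fun c c01 => let: DeriveDef d _ := dh c c01 in d).
have {}cc : 0 <= c <= 1 by case/andP: cc => /ltW -> /ltW ->.
have [b bb E2] := @MVT_line ('D_v g) (z + (c * s) *: v) w s
  (fun b b01 => dw _ (vw c b cc b01)).
have {}bb : 0 <= b <= 1 by case/andP: bb => /ltW -> /ltW ->.
exists (z + (c * s) *: v + (b * s) *: w); first exact: vw.
rewrite -mulrA -E2 -[X in s * X](derive_val (is_derive := dh c cc)) -hE.
by rewrite /h.
Qed.

(** Serves [Schwarz], where the mean value theorem yields equal values at two different points near
    [z]. *)
Lemma eq_limits_near (p q : V -> R) z :
  p @ z --> p z -> q @ z --> q z ->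
  (forall r : R, 0 < r -> exists y1 y2, [/\ `|y1 - z| < r, `|y2 - z| < r & p y1 = q y2]) ->
  p z = q z.
Proof.
move=> cp cq H; apply/eqP; rewrite -subr_eq0 -normr_le0 leNgt; apply/negP => D0.
have D20 : 0 < `|p z - q z| / 2 by rewrite divr_gt0.
have [r1 r10 H1] : exists2 d : R, 0 < d & forall y, `|y - z| < d ->
    `|p z - p y| < `|p z - q z| / 2.
  move/cvgrPdist_lt/(_ _ D20)/nbhs_ballP : cp => [d /= d0 Hd].
  by exists d => // y yd; apply: Hd; rewrite -ball_normE /= distrC.
have [r2 r20 H2] : exists2 d : R, 0 < d & forall y, `|y - z| < d ->
    `|q z - q y| < `|p z - q z| / 2.
  move/cvgrPdist_lt/(_ _ D20)/nbhs_ballP : cq => [d /= d0 Hd].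
  by exists d => // y yd; apply: Hd; rewrite -ball_normE /= distrC.
have [|y1 [y2 [+ + E]]] := H (Num.min r1 r2); first by rewrite lt_min r10.
rewrite !lt_min => /andP[/H1 A _] /andP[_ /H2 B].
suff : `|p z - q z| < `|p z - q z| / 2 + `|p z - q z| / 2 by rewrite -splitr ltxx.
rewrite -{1}(subrKA (p y1)) {2}E.
by apply: le_lt_trans (ler_normD _ _) _; rewrite ltrD// distrC.
Qed.

(** The second difference is symmetric in [v] and [w]; computed in either order it is [s * s] times
    one of the mixed derivatives at a point near [z]. *)
Lemma Schwarz g z v w (r : R) : 0 < r ->
  (forall y, `|y - z| < r -> derivable g y v /\ derivable g y w) ->
  (forall y, `|y - z| < r -> derivable ('D_v g) y w /\ derivable ('D_w g) y v) ->
  'D_w ('D_v g) @ z --> 'D_w ('D_v g) z ->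
  'D_v ('D_w g) @ z --> 'D_v ('D_w g) z ->
  'D_w ('D_v g) z = 'D_v ('D_w g) z.
Proof.
move=> r0 d1 d2 c1 c2; apply: eq_limits_near c1 c2 _ => e e0.
pose m := Num.min r e.
have m0 : 0 < m by rewrite lt_min r0 e0.
have P : 0 < `|v| + `|w| + 1 by rewrite ltr_wpDl// addr_ge0.
pose s := m / (`|v| + `|w| + 1).
have s0 : 0 < s by rewrite divr_gt0.
have sm : s * (`|v| + `|w|) < m by rewrite /s mulrAC ltr_pdivrMr// ltr_pM2l// ltrDl.
have sm' : s * (`|w| + `|v|) < m by rewrite (addrC `|w|).
have mr y : `|y - z| < m -> `|y - z| < r by rewrite lt_min => /andP[].
have me y : `|y - z| < m -> `|y - z| < e by rewrite lt_min => /andP[].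
have [y1 ym1 E1] := second_difference s0 sm (fun y h => (d1 y (mr y h)).1)
  (fun y h => (d2 y (mr y h)).1).
have [y2 ym2 E2] := second_difference s0 sm' (fun y h => (d1 y (mr y h)).2)
  (fun y h => (d2 y (mr y h)).2).
exists y1, y2; split; [exact: me|exact: me|].
have ss : s * s != 0 by rewrite mulf_neq0// gt_eqF.
apply: (mulfI ss); apply: etrans (esym E1) (etrans _ E2).
have alg (a b c d : R) : a - b - (c - d) = a - c - (b - d) by ring.
by rewrite (addrAC z (s *: w)) alg.
Qed.

End Calculus.

Section DirectionalDerivatives.
Context {R : realType} {V : normedModType R}.
Implicit Types (g : V -> R) (z v w : V).

(** The difference quotient splits into the one along [v] and an increment along [w] starting at
    [z + h *: v]; the mean value theorem and the continuity of ['D_w g] at [z] give the limit of the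
    latter. *)
Lemma is_derive_addl g z v w (c d r : R) : 0 < r ->
  is_derive z v g d ->
  (forall y, `|y - z| < r -> derivable g y w) ->
  'D_w g @ z --> 'D_w g z ->
  is_derive z (v + c *: w) g (d + c * 'D_w g z).
Proof.
move=> r0 dv dw cw.
suff H : (fun h : R => h^-1 *: ((g \o shift z) (h *: (v + c *: w)) - g z)) @ 0^' -->
    d + c * 'D_w g z.
  apply: DeriveDef; first by apply/cvg_ex; eexists; exact: H.
  exact: cvg_lim H.
pose q1 (h : R) : R := h^-1 *: ((g \o shift z) (h *: v) - g z).
pose q2 (h : R) : R := h^-1 * (g (z + h *: v + (h * c) *: w) - g (z + h *: v)).
have -> : (fun h : R => h^-1 *: ((g \o shift z) (h *: (v + c *: w)) - g z)) = q1 + q2.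
  apply/funext => h; rewrite /q1 /q2 /= fctE [RHS]/= -mulrDr.
  rewrite [h *: v + z]addrC [in RHS](addrC (_ - _)) subrKA; congr (_ * (g _ - _)).
  by rewrite scalerDr scalerA addrC addrA.
apply: (@cvgD _ _ _ _ (Proper_dnbhs_numFieldType 0)).
  case: dv => dg <-; exact: dg.
have cw' : (fun y => c * 'D_w g y) @ z --> c * 'D_w g z by exact: cvgMr.
apply/cvgrPdist_lt => e e0.
have [r1 /= r10 H1] : exists2 d : R, 0 < d & forall y, `|y - z| < d ->
    `|c * 'D_w g z - c * 'D_w g y| < e.
  move/cvgrPdist_lt/(_ _ e0)/nbhs_ballP : cw' => [k /= k0 Hd].
  by exists k => // y yd; apply: Hd; rewrite -ball_normE /= distrC.
pose m := Num.min r r1.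
have m0 : 0 < m by rewrite lt_min r0.
have P : 0 < `|v| + `|c *: w| + 1 by rewrite ltr_wpDl// addr_ge0.
exists (m / (`|v| + `|c *: w| + 1)) => /=; first by rewrite divr_gt0.
move=> h /=; rewrite sub0r normrN => hm hn0.
have near (t : R) : 0 <= t <= 1 -> `|z + h *: v + (t * (h * c)) *: w - z| < m.
  move=> /andP[t0 t1]; rewrite addrC -addrA addKr.
  have : `|h| * (`|v| + `|c *: w|) < m.
    move: hm; rewrite ltr_pdivlMr//; apply: le_lt_trans.
    by rewrite ler_wpM2l// lerDl.
  apply: le_lt_trans; apply: le_trans (ler_normD _ _) _.
  rewrite mulrDr lerD//; first by rewrite normrZ.
  by rewrite -2!scalerA normrZ ger0_norm// normrZ ler_piMl// mulr_ge0.
have [|t tin E] := @MVT_line R V g (z + h *: v) w (h * c).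
  move=> t t01; apply: dw.
  by have := near t t01; rewrite lt_min => /andP[].
rewrite /q2 E -mulrA mulKf//.
apply: H1; have := near t; rewrite lt_min => /(_ _)/andP[]//.
by case/andP: tin => /ltW -> /ltW ->.
Qed.

End DirectionalDerivatives.

Section CriticalPoints.
Context {R : realType}.

(** Were [d] positive, [psi] would be positive just to the right of [0], and the mean value theorem
    would give [phi s > phi 0]. *)
Lemma critical_second_order (phi psi : R -> R) (d r : R) : 0 < r ->
  (forall s : R, `|s| < r -> is_derive s 1 phi (psi s)) ->
  is_derive (0 : R) 1 psi d ->
  (forall s : R, `|s| < r -> phi s <= phi 0) ->
  psi 0 = 0 /\ d <= 0.
Proof.
move=> r0 dphi dpsi phimax.
have in0 (s : R) : s \in `](- r), r[ -> `|s| < r by rewrite in_itv /= ltr_norml.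
have psi0 : psi 0 = 0.
  have [|_ <-] := dphi 0; first by rewrite normr0.
  have [||||_ ->//] := @derive1_at_max R phi (- r) r 0.
  - by rewrite ge0_cp ?ltW.
  - by move=> t /in0/dphi[].
  - by rewrite in_itv /= oppr_lt0 r0.
  - by move=> t /in0; exact: phimax.
split=> //; rewrite leNgt; apply/negP => d0.
have Q : (fun h : R => h^-1 *: ((psi \o shift 0) (h *: 1) - psi 0)) @ 0^' --> d.
  by case: dpsi => c <-.
have [e /= e0 He] := cvgr_gt _ Q _ d0.
pose s := Num.min e r / 2.
have m0 : 0 < Num.min e r by rewrite lt_min e0.
have s0 : 0 < s by rewrite divr_gt0.
have sm : s < Num.min e r by rewrite /s ltr_pdivrMr// ltr_pMr// ltr1n.
move: (sm); rewrite lt_min => /andP[se sr].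
have [||c cin E] := @MVT R phi psi 0 s s0.
- move=> x; rewrite in_itv /= => /andP[x0 xs]; apply: dphi.
  by rewrite gtr0_norm// (lt_trans xs).
- apply: derivable_within_continuous => x; rewrite in_itv /= => /andP[x0 xs].
  by case: (dphi x) => //; rewrite ger0_norm// (le_lt_trans xs).
move: cin; rewrite in_itv /= => /andP[c0 cs].
have pc : 0 < psi c.
  have := He c; rewrite /= sub0r normrN gtr0_norm// (lt_trans cs se).
  move=> /(_ isT) /(_ (lt0r_neq0 c0)) /=.
  by rewrite psi0 subr0 addr0 [c *: 1]mulr1 pmulr_rgt0// invr_gt0.
have : phi s <= phi 0 by apply: phimax; rewrite gtr0_norm.
by rewrite -subr_le0 E subr0 leNgt mulr_gt0.
Qed.

Lemma directional_max (V : normedModType R) (g psi : V -> R) z v (d r : R) : 0 < r ->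
  (forall y, `|y - z| < r -> is_derive y v g (psi y)) ->
  is_derive z v psi d ->
  (forall y, `|y - z| < r -> g y <= g z) ->
  psi z = 0 /\ d <= 0.
Proof.
move=> r0 dg dpsi gmax.
have P : 0 < `|v| + 1 by rewrite ltr_wpDl.
have near (s : R) : `|s| < r / (`|v| + 1) -> `|z + s *: v - z| < r.
  rewrite [z + _]addrC addrK normrZ ltr_pdivlMr//; apply: le_lt_trans.
  by rewrite ler_wpM2l// lerDl.
have [||||] := @critical_second_order (fun s => g (z + s *: v))
  (fun s => psi (z + s *: v)) d (r / (`|v| + 1)).
- by rewrite divr_gt0.
- move=> s /near/dg[ds <-]; exact: is_derive_line.
- case: dpsi => dp <-; have := @is_derive_line R V psi z v 0.
  by rewrite scale0r addr0; exact.
- by move=> s /near/gmax; rewrite scale0r addr0.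
by rewrite scale0r addr0.
Qed.
End CriticalPoints.

(** Coordinates are added one at a time by [is_derive_addl], which asks of the direction built so
    far only a derivative at [z]. *)
Lemma is_derive_partials (R : realType) n (g : 'rV[R]_n -> R) (z : 'rV[R]_n) (r : R) : 0 < r ->
  (forall (y : 'rV[R]_n) i, `|y - z| < r -> derivable g y (ev i)) ->
  (forall i, 'D_(ev i) g @ z --> 'D_(ev i) g z) ->
  forall xi : 'rV[R]_n, is_derive z xi g (\sum_(i < n) xi 0 i * 'D_(ev i) g z).
Proof.
move=> r0 dg cg xi; rewrite [X in is_derive _ X](row_sum_delta xi).
elim: (index_enum _) => [|i s IH].
  rewrite !big_nil.
  have E : (fun h : R => h^-1 *: ((g \o shift z) (h *: 0) - g z)) = cst 0.
    by apply/funext => h /=; rewrite scaler0 add0r subrr scaler0.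
  apply: DeriveDef; rewrite /derivable /derive E; first exact: is_cvg_cst.
  exact: lim_cst.
rewrite !big_cons addrC [X in is_derive _ _ _ X]addrC.
exact: (is_derive_addl (xi 0 i) r0 IH (fun y => dg y i) (cg i)).
Qed.

Section SecondOrder.
Context {R : realType} {n : nat}.
Implicit Types (g : 'rV[R]_n -> R) (z xi : 'rV[R]_n) (G : set 'rV[R]_n).

Lemma open_norm_ball G z : open G -> G z ->
  exists2 r : R, 0 < r & forall y, `|y - z| < r -> G y.
Proof.
move=> oG Gz; have /nbhs_ballP[r /= r0 H] := open_nbhs_nbhs (conj oG Gz).
by exists r => // y yr; apply: H; rewrite -ball_normE /= distrC.
Qed.

Lemma C2_directional G g : open G ->
  (forall z i, G z -> derivable g z (ev i)) ->
  (forall z i j, G z -> derivable ('D_(ev j) g) z (ev i)) ->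
  (forall z i, G z -> 'D_(ev i) g @ z --> 'D_(ev i) g z) ->
  (forall z i j, G z -> 'D_(ev i) ('D_(ev j) g) @ z --> 'D_(ev i) ('D_(ev j) g) z) ->
  forall z, G z ->
  [/\ forall xi, is_derive z xi g (\sum_(i < n) xi 0 i * 'D_(ev i) g z),
      forall xi j, is_derive z xi ('D_(ev j) g)
        (\sum_(i < n) xi 0 i * 'D_(ev i) ('D_(ev j) g) z) &
      forall i j, 'D_(ev i) ('D_(ev j) g) z = 'D_(ev j) ('D_(ev i) g) z].
Proof.
move=> oG d1 d2 c1 c2 z Gz.
have [r r0 rG] := open_norm_ball oG Gz.
split.
- apply: (is_derive_partials r0) => [y i /rG Gy|i]; [exact: d1|exact: c1].
- move=> xi j; apply: (is_derive_partials r0) => [y i /rG Gy|i]; [exact: d2|exact: c2].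
- move=> i j; apply: (Schwarz r0).
  + by move=> y /rG Gy; split; exact: d1.
  + by move=> y /rG Gy; split; exact: d2.
  + exact: c2.
  + exact: c2.
Qed.

(** On the line through [z] in direction [xi] the first derivative vanishes and the second, the form
    of [H] at [xi], is nonpositive; [trace_sym_le0] pairs this with [A]. *)
Lemma second_order_max g (p : 'I_n -> 'rV[R]_n -> R) (H A : 'M[R]_n) z (r : R) : 0 < r ->
  (forall y xi, `|y - z| < r -> is_derive y xi g (\sum_(i < n) xi 0 i * p i y)) ->
  (forall xi j, is_derive z xi (p j) (\sum_(i < n) xi 0 i * H i j)) ->
  H^T = H ->
  (forall xi, 0 <= (xi *m A *m xi^T) 0 0) ->
  (forall y, `|y - z| < r -> g y <= g z) ->
  (forall i, p i z = 0) /\ \sum_i \sum_j A i j * H i j <= 0.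
Proof.
move=> r0 dg dp Hs Ap gmax.
pose psi xi (y : 'rV[R]_n) := \sum_(i < n) xi 0 i * p i y.
have dpsi xi : is_derive z xi (psi xi) (\sum_(j < n) xi 0 j * (\sum_(i < n) xi 0 i * H i j)).
  have -> : psi xi = \sum_(i < n) (xi 0 i *: p i).
    by apply/funext => y; rewrite fct_sumE.
  by apply: is_derive_sum => i; exact: is_deriveZ.
have K xi := @directional_max R _ g (psi xi) z xi _ r r0 (fun y => dg y xi) (dpsi xi) gmax.
split.
  move=> i; have [+ _] := K (ev i).
  rewrite /psi (bigD1 i)//= big1 ?addr0; last first.
    by move=> j ji; rewrite mxE eqxx (negbTE ji) mul0r.
  by rewrite mxE !eqxx mul1r.
apply: trace_sym_le0 => // xi; have [_] := K xi.
congr (_ <= _); rewrite mxE; apply: eq_bigr => j _.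
by rewrite !mxE mulrC.
Qed.

End SecondOrder.

(** * Comparison principle *)

Section Comparison.
Context {R : realType} {n : nat}.
Implicit Types (G : set 'rV[R]_n) (x : R -> 'rV[R]_n -> R).

Lemma slice_cvg G (F : R -> 'rV[R]_n -> R) (t : R) z : open G -> 0 < t -> G z ->
  {within [set q : R * 'rV[R]_n | 0 < q.1 /\ G q.2], continuous (fun q => F q.1 q.2)} ->
  F t @ z --> F t z.
Proof.
move=> oG t0 Gz /subspace_continuousP /(_ (t, z) (conj t0 Gz)) /= H.
apply: (cvg_comp (fun y : 'rV[R]_n => (t, y)) (fun q => F q.1 q.2) _ H) => A /=.
rewrite /within /= => -[[B1 B2] /= [B1t B2z] BA].
apply: filterS2 B2z (open_nbhs_nbhs (conj oG Gz)) => y By Gy.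
apply: (BA (t, y)) => //; split => //; exact: nbhs_singleton B1t.
Qed.

Lemma CL_directional G x (t : R) z : open G -> CL G x -> 0 < t -> G z ->
  [/\ forall xi, is_derive z xi (x t) (\sum_(i < n) xi 0 i * dz i x t z),
      forall xi j, is_derive z xi (dz j x t) (\sum_(i < n) xi 0 i * d2 i j x t z) &
      forall i j, d2 i j x t z = d2 j i x t z].
Proof.
move=> oG [_ dx _ cz c2] t0 Gz.
apply: (C2_directional oG _ _ _ _ Gz).
- by move=> y i Gy; have [_ /(_ i)[]] := dx t y t0 Gy.
- by move=> y i j Gy; have [_ /(_ i)[_]] := dx t y t0 Gy.
- by move=> y i Gy; exact: (slice_cvg oG t0 Gy (cz i)).
- by move=> y i j Gy; exact: (slice_cvg oG t0 Gy (c2 i j)).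
Qed.

(** Only earlier times are compared, since a maximum over a time interval may sit at its right
    end. *)
Lemma derive_ge0_left_max (g : R -> R) (b t d : R) : b < t -> is_derive t 1 g d ->
  (forall s, b < s < t -> g s <= g t) -> 0 <= d.
Proof.
move=> bt dg gmax; rewrite leNgt; apply/negP => d0.
have Q : (fun h : R => h^-1 *: ((g \o shift t) (h *: 1) - g t)) @ 0^' --> d.
  by case: dg => c <-.
have [e /= e0 He] := cvgr_lt _ Q _ d0.
pose s := Num.min e (t - b) / 2.
have m0 : 0 < Num.min e (t - b) by rewrite lt_min e0 subr_gt0.
have s0 : 0 < s by rewrite divr_gt0.
have sm : s < Num.min e (t - b) by rewrite /s ltr_pdivrMr// ltr_pMr// ltr1n.
move: (sm); rewrite lt_min => /andP[se sr].
have := He (- s); rewrite /= sub0r opprK gtr0_norm// => /(_ se).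
rewrite oppr_eq0 gt_eqF// => /(_ isT).
rewrite [_ *: 1]mulr1 invrN scaleNr oppr_lt0 pmulr_rgt0 ?invr_gt0// subr_gt0.
rewrite ltNge gmax//; apply/andP; split; lra.
Qed.

(** The last hypothesis is maximality of the exponentially weighted difference. With [m] the
    difference at [(t, z)], it makes the time derivative at least [k * m], while the elliptic part
    is [<= 0] and, the gradients being equal, the nonlinear part is below [k * m]. *)
Lemma parabolic_max_contradiction G (a : 'I_n -> 'I_n -> 'rV[R]_n -> R) f x1 x2
    (K k t : R) z :
  open G -> CL G x1 -> CL G x2 -> 0 < t -> G z -> 0 < K ->
  (forall xi, \sum_(i < n) \sum_(j < n) a i j z * xi 0 i * xi 0 j >= K * euclid xi ^+ 2) ->
  Lop a f x1 t z = 0 -> Lop a f x2 t z = 0 ->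
  (forall xi, f z (x1 t z) xi - f z (x2 t z) xi < k * (x1 t z - x2 t z)) ->
  (forall y, G y -> x1 t y - x2 t y <= x1 t z - x2 t z) ->
  (forall s, 0 < s < t ->
     x1 s z - x2 s z <= (x1 t z - x2 t z) * expR (k * (s - t))) ->
  False.
Proof.
(* The closing arithmetic: time derivatives [e1], [e2], elliptic sums [s1], [s2], nonlinear terms
   [f1], [f2], and [l = k * m]. *)
have fin (e1 e2 s1 s2 f1 f2 l : R) : e1 - s1 - f1 = 0 -> e2 - s2 - f2 = 0 ->
    f1 - f2 < l -> s1 - s2 <= 0 -> 0 <= e1 - e2 - l -> False by lra.
move=> oG C1 C2 t0 Gz K0 ell L1 L2 fk zmax tmax.
have [r r0 rG] := open_norm_ball oG Gz.
have [_ D1 S1] := CL_directional oG C1 t0 Gz.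
have [_ D2 S2] := CL_directional oG C2 t0 Gz.
pose A := \matrix_(i, j) a i j z.
pose H := \matrix_(i, j) (d2 i j x1 t z - d2 i j x2 t z).
have [gr tr] : (forall i, dz i x1 t z - dz i x2 t z = 0) /\
    \sum_i \sum_j A i j * H i j <= 0.
  apply: (@second_order_max R n (x1 t - x2 t) (fun i => dz i x1 t - dz i x2 t) H A z r r0).
  - move=> y xi /rG Gy.
    have [E1 _ _] := CL_directional oG C1 t0 Gy.
    have [E2 _ _] := CL_directional oG C2 t0 Gy.
    have -> : \sum_(i < n) xi 0 i * (dz i x1 t - dz i x2 t) y =
       \sum_(i < n) xi 0 i * dz i x1 t y - \sum_(i < n) xi 0 i * dz i x2 t y.
      by rewrite -sumrB; apply: eq_bigr => i _; rewrite -mulrBr.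
    by have := is_deriveB (E1 xi) (E2 xi).
  - move=> xi j.
    have -> : \sum_(i < n) xi 0 i * H i j =
       \sum_(i < n) xi 0 i * d2 i j x1 t z - \sum_(i < n) xi 0 i * d2 i j x2 t z.
      by rewrite -sumrB; apply: eq_bigr => i _; rewrite mxE -mulrBr.
    by have := is_deriveB (D1 xi j) (D2 xi j).
  - by apply/matrixP => i j; rewrite !mxE S1 S2.
  - move=> xi; have := ell xi.
    have -> : \sum_(i < n) \sum_(j < n) a i j z * xi 0 i * xi 0 j = (xi *m A *m xi^T) 0 0.
      rewrite mxE exchange_big; apply: eq_bigr => j _.
      rewrite !mxE mulr_suml; apply: eq_bigr => i _.
      by rewrite mxE [xi 0 i * _]mulrC.
    by apply: le_trans; rewrite mulr_ge0 ?sqr_ge0// ltW.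
  - by move=> y /rG; exact: zmax.
have gg : grad x1 t z = grad x2 t z.
  by apply/rowP => i; rewrite !mxE; apply/eqP; rewrite -subr_eq0 gr.
set m := x1 t z - x2 t z in fk tmax.
(* The exponential majorant touches the difference at [s = t], with slope [k * m] there. *)
have dE : is_derive t 1 (fun s : R => m * expR (k * (s - t))) (k * m).
  have d2 : is_derive t 1 (fun s : R => k * (s - t)) k.
    have := @is_deriveZ _ _ _ (fun s : R => s - t) k t 1 1.
    rewrite [_ *: 1]mulr1; apply.
    have := @is_deriveB _ _ _ id (cst t) t 1 1 0 (is_derive_id _ _) (is_derive_cst _ _ _).
    by rewrite subr0.
  have d1 : is_derive (k * (t - t)) 1 expR 1.
    by have := is_derive_expR (k * (t - t)); rewrite {2}subrr mulr0 expR0.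
  rewrite [k * m]mulrC; have := @is_deriveZ _ _ _ (expR \o (fun s : R => k * (s - t))) m t 1 k.
  apply; rewrite -[X in is_derive _ _ _ X]mul1r; exact: is_derive1_comp.
have dT x : CL G x -> is_derive t 1 (fun s => x s z) (dt x t z).
  by case=> _ /(_ t z t0 Gz)[/derivableP d _] _ _ _.
have dg : is_derive t 1 (fun s => x1 s z - x2 s z - m * expR (k * (s - t)))
    (dt x1 t z - dt x2 t z - k * m).
  exact: (is_deriveB (is_deriveB (dT _ C1) (dT _ C2)) dE).
have : 0 <= dt x1 t z - dt x2 t z - k * m.
  apply: (derive_ge0_left_max t0 dg) => s s0t.
  by rewrite subrr mulr0 expR0 mulr1 -/m subrr subr_le0 tmax.
have {tr} : \sum_(i < n) \sum_(j < n) a i j z * d2 i j x1 t z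
    - \sum_(i < n) \sum_(j < n) a i j z * d2 i j x2 t z <= 0.
  congr (_ <= _): tr; rewrite -sumrB; apply: eq_bigr => i _.
  by rewrite -sumrB; apply: eq_bigr => j _; rewrite !mxE mulrBr.
move: L1 L2 (fk (grad x1 t z)); rewrite /Lop -gg.
exact: fin.
Qed.
End Comparison.

Lemma compact_within_bounded (R : realType) (T : topologicalType) (A : set T) (g : T -> R) :
  compact A -> {within A, continuous g} -> exists2 M : R, 0 < M & forall x, A x -> `|g x| < M.
Proof.
move=> cA cg; have /ex_strict_bound_gt0[M M0 H] : bounded_set (g @` A).
  exact/compact_bounded/continuous_compact.
by exists M => // x Ax; apply: H; exists x.
Qed.

Lemma compact_closure_bounded (R : realType) n (G : set 'rV[R]_n) :
  bounded_set G -> compact (closure G).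
Proof.
move=> /ex_strict_bound_gt0[M M0 GM].
apply: bounded_closed_compact; last exact: closed_closure.
have cM : closed [set y : 'rV[R]_n | `|y| <= M].
  have := @closed_comp _ _ (@Num.norm _ 'rV[R]_n) [set r : R | r <= M].
  by apply => [y _|]; [exact: norm_continuous|exact: closed_le].
have sub : closure G `<=` [set y : 'rV[R]_n | `|y| <= M].
  rewrite [X in _ `<=` X](closure_id _).1//.
  by apply: closure_subset => y /GM /= /ltW.
by exists M; split; [exact: num_real|move=> r Mr y /sub /le_trans; apply; exact: ltW].
Qed.

Lemma comparison_principle (R : realType) (n : nat) (G : set 'rV[R]_n)
    (a : 'I_n -> 'I_n -> 'rV[R]_n -> R) f (x1 x2 : R -> 'rV[R]_n -> R) :
  standing G a f -> H2 G f -> CL G x1 -> CL G x2 ->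
  (forall t z, 0 < t -> G z -> Lop a f x1 t z = 0) ->
  (forall t z, 0 < t -> G z -> Lop a f x2 t z = 0) ->
  (forall z, G z -> x1 0 z <= x2 0 z) ->
  (forall t z, 0 <= t -> bdry G z -> x1 t z <= x2 t z) ->
  forall t z, 0 <= t -> closure G z -> x1 t z <= x2 t z.
Proof.
move=> [oG bG _ [K K0 ell] _] [H2 _] C1 C2 L1 L2 init bd T z T0 Gz.
pose C := `[0, T]%classic `*` closure G : set (R * 'rV[R]_n).
have cC : compact C.
  apply: compact_setX; first exact: segment_compact.
  exact: compact_closure_bounded.
have CW : C `<=` [set q : R * 'rV[R]_n | 0 <= q.1 /\ closure G q.2].
  by move=> [s y] [/=]; rewrite in_itv /= => /andP[].
have c1 : {within C, continuous (fun q => x1 q.1 q.2)}.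
  by case: C1 => c _ _ _ _; exact: continuous_subspaceW c.
have c2 : {within C, continuous (fun q => x2 q.1 q.2)}.
  by case: C2 => c _ _ _ _; exact: continuous_subspaceW c.
have [M1 M10 B1] := compact_within_bounded cC c1; have [M2 M20 B2] := compact_within_bounded cC c2.
(* [W] contains all values of both solutions on the cylinder [C], so one constant [k] serves
   throughout. *)
pose W := [set w : R | `|w| < M1 + M2].
have bW : bounded_set W.
  exists (M1 + M2); split; first exact: num_real.
  by move=> r Mr y /= /lt_trans /(_ Mr) /ltW.
have [k k0 fk] := H2 W bW.
pose h (q : R * 'rV[R]_n) := (x1 q.1 q.2 - x2 q.1 q.2) * expR (- k * q.1).
have ch : {within C, continuous h}.
  move=> q; apply: cvgM; first by apply: cvgB; [exact: c1|exact: c2].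
  have : {within C, continuous (fun q : R * 'rV[R]_n => expR (- k * q.1))}.
    apply: continuous_subspaceT => p.
    apply: (@continuous_comp _ _ _ (fun p : R * 'rV[R]_n => - k * p.1) expR).
      by apply: cvgMr; exact: cvg_fst.
    exact: continuous_expR.
  exact.
have C0 : C !=set0.
  by exists (T, z); split => //=; rewrite in_itv /= lexx T0.
have [[t0 z0] + hmax] := compact_EVT_max C0 cC ch.
rewrite inE => -[/=]; rewrite in_itv /= => /andP[t00 t0T] Gz0.
have hm s y : 0 <= s <= T -> closure G y ->
    (x1 s y - x2 s y) * expR (- k * s) <= (x1 t0 z0 - x2 t0 z0) * expR (- k * t0).
  by move=> sT Gy; apply: (hmax (s, y)); rewrite inE; split; rewrite //= in_itv.
(* A nonpositive maximum of [h] gives the claim at once; a positive one is refuted below. *)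
rewrite -subr_le0; have [m0|m0] := leP (x1 t0 z0 - x2 t0 z0) 0.
  rewrite -(pmulr_lle0 _ (expR_gt0 (- k * T))).
  apply: le_trans (hm T z _ Gz) _; first by rewrite lexx T0.
  by rewrite pmulr_lle0 ?expR_gt0.
exfalso.
(* A positive maximum lies neither on the lateral boundary nor at time [0], where the data are
   ordered. *)
have Gz0' : G z0.
  apply: contrapT => nG; move: m0; rewrite subr_gt0 ltNge bd//.
have t0p : 0 < t0.
  rewrite lt_neqAle t00 andbT; apply/eqP => E.
  by move: m0; rewrite -E subr_gt0 ltNge init.
have Wx : W (x1 t0 z0) /\ W (x2 t0 z0).
  have Cq : C (t0, z0) by split; rewrite //= in_itv /= t00.
  by split; rewrite /W /=; [have := B1 _ Cq|have := B2 _ Cq] => /=; lra.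
apply: (@parabolic_max_contradiction R n G a f x1 x2 K k t0 z0) => //.
- by move=> xi; exact: ell.
- exact: L1.
- exact: L2.
- by move=> xi; apply: fk => //; [exact: Wx.1|exact: Wx.2|rewrite -subr_gt0].
- move=> y Gy; have := hm t0 y; rewrite t00 t0T => /(_ isT (subset_closure Gy)).
  by rewrite ler_pM2r ?expR_gt0.
- move=> s /andP[s0 st]; have := hm s z0.
  rewrite (ltW s0) (ltW (lt_le_trans st t0T)) => /(_ isT Gz0).
  rewrite -ler_pdivlMr ?expR_gt0// -expRN -mulrA -expRD.
  by congr (_ <= _ * expR _); ring.
Qed.

(** * Iterated integrals and [L^p] norms *)

Section LowerSemicontinuity.
Context {R : realType} {n : nat}.
Implicit Types (F : 'rV[R]_n -> \bar R) (z : 'rV[R]_n) (k : nat).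

Lemma upd_ball k z y (s t e : R) : 0 < e ->
  ball z e y -> ball s e t -> ball (upd z k s) e (upd y k t).
Proof.
by move=> e0 [_ zy] st; split => // i j; rewrite !mxE; case: ifP => // _; rewrite ord1; exact: zy.
Qed.

Lemma lower_semicontinuous_upd F k z :
  lower_semicontinuous F -> lower_semicontinuous (fun t : R => F (upd z k t)).
Proof.
move=> lF t b /lF[V /nbhs_ballP[e /= e0 eV] VF].
exists (ball t e); first exact: nbhsx_ballx.
by move=> s ts; apply: VF; apply: eV; apply: upd_ball => //; exact: ballxx.
Qed.

Lemma measurable_upd F k z :
  lower_semicontinuous F -> measurable_fun setT ((fun t : R => F (upd z k t)) : R -> \bar R).
Proof.
by move=> lF; apply: lower_semicontinuous_measurable; exact: lower_semicontinuous_upd.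
Qed.

Lemma limn_einf_sup_einfs (u : (\bar R)^nat) :
  limn_einf u = ereal_sup (range (einfs u)).
Proof. by rewrite limn_einf_lim; apply/cvg_lim => //; exact: cvg_einfs_sup. Qed.

(** [lower_semicontinuous] is tested against real thresholds only; this turns such tests into an
    inequality in [\bar R]. *)
Lemma lee_of_lt (x y : \bar R) : (0 <= y)%E ->
  (forall b : R, (b%:E < x)%E -> (b%:E <= y)%E) -> (x <= y)%E.
Proof.
move=> y0 H; rewrite leNgt; apply/negP => yx.
move: y y0 H yx => [y| |] // _ H yx; last by rewrite ltNge leey in yx.
have [b yb bx] : exists2 b : R, y < b & (b%:E < x)%E.
  move: x yx {H} => [x| |] // yx; last by exists (y + 1); rewrite ?ltrDl ?ltry.
  rewrite lte_fin in yx; exists ((y + x) / 2); last rewrite lte_fin; lra.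
by have := H b bx; rewrite lee_fin leNgt yb.
Qed.

Lemma lower_semicontinuous_limn_einf F z (y : nat -> 'rV[R]_n) :
  (forall x, (0 <= F x)%E) ->
  lower_semicontinuous F -> y @ \oo --> z -> (F z <= limn_einf (F \o y))%E.
Proof.
move=> F0 lF yz; rewrite limn_einf_sup_einfs.
have ub m : (einfs (F \o y) m <= ereal_sup (range (einfs (F \o y))))%E.
  by apply: ereal_sup_ubound; exists m.
apply: lee_of_lt.
  apply: le_trans (ub 0); apply: le_ereal_inf_tmp => _ [m /= _ <-]; exact: F0.
move=> b /lF[V zV VF].
have [N _ HN] := yz _ zV.
apply: le_trans (ub N); apply: le_ereal_inf_tmp => _ [m /= Nm <-].
by apply/ltW/VF/HN.
Qed.

(** If it failed at [z], some sequence tending to [z] would keep the integrals at most [b];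
    semicontinuity of [F] under the integral and Fatou's lemma would then bound the integral at [z]
    by [b]. *)
Lemma lower_semicontinuous_integral_upd F k :
  (forall x, (0 <= F x)%E) -> lower_semicontinuous F ->
  lower_semicontinuous (fun z => \int[lebesgue_measure]_t F (upd z k t))%E.
Proof.
move=> F0 lF z b bz; apply: contrapT => nV.
have bad m : exists y : 'rV[R]_n, ball z m.+1%:R^-1 y /\
    (\int[lebesgue_measure]_t F (upd y k t) <= b%:E)%E.
  apply: contrapT => H; apply: nV; exists (ball z m.+1%:R^-1).
    by apply: nbhsx_ballx; rewrite invr_gt0.
  by move=> y zy; rewrite ltNge; apply/negP => yb; apply: H; exists y.
have [y Hy] := choice bad.
have yz t : (fun m => upd (y m) k t) @ \oo --> upd z k t.
  apply/cvg_ballP => e e0; near=> m.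
  apply: upd_ball => //; last exact: ballxx.
  have [+ _] := Hy m; apply: le_ball; apply: ltW.
  by near: m; exact: near_infty_natSinv_lt (PosNum e0).
have fat := @fatou _ _ R lebesgue_measure setT measurableT
  (fun m t => F (upd (y m) k t)) (fun m => measurable_upd k (y m) lF) (fun m t _ => F0 _).
suff : (\int[lebesgue_measure]_t F (upd z k t) <= b%:E)%E by rewrite leNgt bz.
apply: le_trans (le_trans fat _).
  apply: ge0_le_integral => //.
  - exact: measurable_upd.
  - rewrite /limn_einf; apply: measurableT_comp => //.
    apply: measurable_fun_limn_esup => m; apply: measurableT_comp => //.
    exact: measurable_upd.
  - by move=> t _; have := lower_semicontinuous_limn_einf F0 lF (yz t).
(* Each tail infimum is at most its first term, hence at most [b]. *)
rewrite limn_einf_sup_einfs; apply: ge_ereal_sup => _ [m _ <-].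
apply: le_trans (Hy m).2; apply: ereal_inf_lbound; by exists m => /=.
Unshelve. all: by end_near. Qed.

Lemma iint_lower_semicontinuous F k :
  (forall x, (0 <= F x)%E) -> lower_semicontinuous F ->
  (forall x, (0 <= iint k F x)%E) /\ lower_semicontinuous (iint k F).
Proof.
move=> F0 lF; elim: k => //= k [I0 lI]; split.
  by move=> x; exact: integral_ge0.
exact: lower_semicontinuous_integral_upd.
Qed.

Lemma iint_le_linear F F1 F2 (a b : R) k z :
  0 <= a -> 0 <= b ->
  (forall x, (0 <= F x)%E) -> lower_semicontinuous F ->
  (forall x, (0 <= F1 x)%E) -> lower_semicontinuous F1 ->
  (forall x, (0 <= F2 x)%E) -> lower_semicontinuous F2 ->
  (forall x, (F x <= a%:E * F1 x + b%:E * F2 x)%E) ->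
  (iint k F z <= a%:E * iint k F1 z + b%:E * iint k F2 z)%E.
Proof.
move=> a0 b0 F0 lF F10 lF1 F20 lF2 FF.
elim: k z => //= k IH z.
have [I0 lI] := iint_lower_semicontinuous k F0 lF.
have [I10 lI1] := iint_lower_semicontinuous k F10 lF1.
have [I20 lI2] := iint_lower_semicontinuous k F20 lF2.
have m1 := measurable_upd k z lI1; have m2 := measurable_upd k z lI2.
have ma : measurable_fun setT ((fun t : R => a%:E * iint k F1 (upd z k t)) : R -> \bar R)%E.
  exact: measurable_funeM.
have mb : measurable_fun setT ((fun t : R => b%:E * iint k F2 (upd z k t)) : R -> \bar R)%E.
  exact: measurable_funeM.
rewrite -!ge0_integralZl_EFin// -ge0_integralD//; last 2 first.
- by move=> t _; rewrite mule_ge0.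
- by move=> t _; rewrite mule_ge0.
apply: ge0_le_integral => //; first exact: measurable_upd.
exact: emeasurable_funD.
Qed.

(** [iint k] overwrites only coordinates below [k], so a coordinate [j >= k] of [z] outside the box
    survives into every evaluation of [F]. *)
Lemma iint_supported F (B : R) k z (j : 'I_n) :
  (forall (x : 'rV[R]_n) (i : 'I_n), B < `|x 0 i| -> F x = 0%E) ->
  (k <= j)%N -> B < `|z 0 j| -> iint k F z = 0%E.
Proof.
move=> F0; elim: k z => [|k IH] z /= kj zj; first exact: F0 zj.
rewrite integral0_eq// => t _; apply: IH; first exact: ltnW.
by rewrite mxE gtn_eqF.
Qed.

Lemma iint_bounded F (B M : R) k z : 0 <= B -> 0 <= M ->
  (forall x, (0 <= F x)%E) -> lower_semicontinuous F ->
  (forall x, (F x <= M%:E)%E) ->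
  (forall (x : 'rV[R]_n) (i : 'I_n), B < `|x 0 i| -> F x = 0%E) ->
  (k <= n)%N -> (iint k F z <= (M * (2 * B) ^+ k)%:E)%E.
Proof.
move=> B0 M0 F0 lF FM Fs; elim: k z => [|k IH] z kn /=; first by rewrite expr0 mulr1.
have [I0 lI] := iint_lower_semicontinuous k F0 lF.
set c := M * (2 * B) ^+ k.
have c0 : 0 <= c by rewrite mulr_ge0// exprn_ge0// mulr_ge0.
(* Outside [[-B, B]] the inner integral is zero, by [iint_supported] for coordinate [k]; this
   integration therefore contributes one factor [2 * B]. *)
apply: (@le_trans _ _ (\int[lebesgue_measure]_(t in `[(- B)%R, B]) c%:E)%E).
  rewrite [leRHS]integral_mkcond; apply: ge0_le_integral => //.
  - exact: measurable_upd.
  - by apply/(measurable_restrictT _ _).1 => //; exact: measurable_cst.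
  - move=> t _; rewrite patchE; case: ifPn => tB; first by apply: IH; exact: ltnW.
    rewrite (@iint_supported F B k _ (Ordinal kn))//=.
    rewrite mxE eqxx ltNge; apply: contra tB => tB.
    by rewrite inE /= in_itv /= -ler_norml.
rewrite integral_cst//= lebesgue_measure_itv/= lte_fin.
(* For [B = 0] the length formula returns [0]. *)
case: ifP => _; last by rewrite mule0 lee_fin mulr_ge0// exprn_ge0// mulr_ge0.
rewrite -EFinD -EFinM lee_fin exprSr mulrA -/c ler_wpM2l//; lra.
Qed.

End LowerSemicontinuity.

Section LpNorm.
Context {R : realType} {n : nat}.
Variables (G : set 'rV[R]_n) (oG : open G) (bG : bounded_set G).
Implicit Types (g : 'rV[R]_n -> R) (z : 'rV[R]_n) (r : R).

(** Written exactly as the integrand of [Lpnorm], so that the norm folds into it. *)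
Let powG r g z : \bar R := if `[< G z >] then (`|g z| `^ r)%:E else 0%E.

Let powG_ge0 r g z : (0 <= powG r g z)%E.
Proof. by rewrite /powG; case: ifP => // _; rewrite lee_fin powR_ge0. Qed.

Lemma root_powR (x r : R) : 0 < r -> 0 <= x -> (x `^ r^-1) `^ r = x.
Proof. by move=> r0 x0; rewrite -powRrM mulVf ?gt_eqF// powRr1. Qed.

Lemma powR_root (x r : R) : 0 < r -> 0 <= x -> (x `^ r) `^ r^-1 = x.
Proof. by move=> r0 x0; rewrite -powRrM mulfV ?gt_eqF// powRr1. Qed.

Lemma ler_powR_root (x y r : R) : 0 < r -> 0 <= y -> 0 <= x -> x <= y `^ r -> x `^ r^-1 <= y.
Proof.
move=> r0 y0 x0 xy; rewrite -[leRHS](powR_root r0)//.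
by apply: ge0_ler_powR; rewrite ?nnegrE ?powR_ge0// invr_ge0 ltW.
Qed.

(** On the open set [G] continuity suffices; off [G] the value is the minimum [0], which exceeds
    only negative thresholds. *)
Let powG_lsc r g : 0 < r -> {within closure G, continuous g} ->
  lower_semicontinuous (powG r g).
Proof.
move=> r0 cg z b; have [b0 _|b0] := ltP b 0.
  exists setT; first exact: filterT.
  by move=> y _; apply: lt_le_trans (powG_ge0 _ _ _); rewrite lte_fin.
rewrite {1}/powG; case: asboolP => [Gz|_]; last by rewrite lte_fin ltNge b0.
rewrite lte_fin => bz.
have cz : (fun y => `|g y|) @ z --> `|g z|.
  have : {within G, continuous g} by exact: continuous_subspaceW (@subset_closure _ G) cg.
  rewrite continuous_open_subspace// => /(_ z (mem_set Gz)) cz.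
  exact: (@cvg_norm R R^o _ (nbhs z) _ g (g z) cz).
have bz' : b `^ r^-1 < `|g z|.
  rewrite -[ltRHS](powR_root r0)//; apply: gt0_ltr_powR; rewrite ?invr_gt0// ?nnegrE//.
exists [set y | G y /\ b `^ r^-1 < `|g y|].
  apply: filterI; first exact: open_nbhs_nbhs.
  exact: (cvgr_gt _ cz _ bz').
move=> y [Gy gy]; rewrite /powG; case: asboolP => // _; rewrite lte_fin.
rewrite -[ltLHS](root_powR r0)//; apply: gt0_ltr_powR; rewrite ?nnegrE//.
exact: powR_ge0.
Qed.

(** [fine] sends an infinite integral to [0], so estimates of the norm need finiteness; it comes
    from bounds on [g] and on [G]. *)
Let powG_fin r g : 0 < r -> {within closure G, continuous g} ->
  iint n (powG r g) 0 \is a fin_num.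
Proof.
move=> r0 cg; have l := powG_lsc r0 cg.
have [I0 _] := iint_lower_semicontinuous n (powG_ge0 r g) l.
rewrite ge0_fin_numE//.
have [M M0 gM] := compact_within_bounded (compact_closure_bounded bG) cg.
have [B B0 GB] := ex_strict_bound_gt0 bG.
apply: (@le_lt_trans _ _ (M `^ r * (2 * B) ^+ n)%:E); last exact: ltry.
apply: iint_bounded => //; first exact: ltW.
- exact: powR_ge0.
- move=> x; rewrite /powG; case: asboolP => Gx; last by rewrite lee_fin powR_ge0.
  rewrite lee_fin; apply: ge0_ler_powR; rewrite ?nnegrE//; try exact: ltW.
  by apply/ltW/gM/subset_closure.
- move=> x i Bx; rewrite /powG; case: asboolP => // Gx.
  have := GB x Gx; rewrite /= ltNge => /negP; case; apply: le_trans (ltW Bx) _.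
  rewrite /Num.norm /= mx_normrE; apply/bigmax_geP; right => /=.
  by exists (ord0, i).
Qed.

(** A sum is at most twice the larger of its two terms. *)
Let powR_sum_le r (u v : R) : 0 < r -> 0 <= u -> 0 <= v ->
  (u + v) `^ r <= (2 * u) `^ r + (2 * v) `^ r.
Proof.
wlog uv : u v / u <= v => [H|] r0 u0 v0.
  have [uv|/ltW vu] := leP u v; first exact: H.
  by rewrite addrC [leRHS]addrC; exact: H.
apply: (@le_trans _ _ ((2 * v) `^ r)); last by rewrite lerDr powR_ge0.
by apply: ge0_ler_powR; rewrite ?nnegrE ?(ltW r0) ?addr_ge0 ?mulr_ge0//; lra.
Qed.

(* The constant [4] replaces Minkowski's inequality: [(u + v)^r <= (2u)^r + (2v)^r]
   is applied pointwise, and [s^r + s^r <= (2s)^r] to the integrals. *)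
Lemma Lpnorm_le_linear (p : \bar R) g g1 g2 (a b : R) : (1 <= p)%E ->
  0 <= a -> 0 <= b ->
  {within closure G, continuous g} ->
  {within closure G, continuous g1} ->
  {within closure G, continuous g2} ->
  (forall z, G z -> `|g z| <= a * `|g1 z| + b * `|g2 z|) ->
  Lpnorm G p g <= 4 * (a * Lpnorm G p g1 + b * Lpnorm G p g2).
Proof.
case: p => [r| |//] r1 a0 b0 cg cg1 cg2 gle; rewrite /Lpnorm.
  rewrite lee_fin in r1; have r0 : 0 < r by exact: lt_le_trans ltr01 r1.
  rewrite -!/(powG _ _).
  have f := powG_fin r0 cg; have f1 := powG_fin r0 cg1; have f2 := powG_fin r0 cg2.
  have l := powG_lsc r0 cg; have l1 := powG_lsc r0 cg1; have l2 := powG_lsc r0 cg2.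
  have [I0 _] := iint_lower_semicontinuous n (powG_ge0 r g) l.
  have [I10 _] := iint_lower_semicontinuous n (powG_ge0 r g1) l1.
  have [I20 _] := iint_lower_semicontinuous n (powG_ge0 r g2) l2.
  have key z : (powG r g z <= ((2 * a) `^ r)%:E * powG r g1 z + ((2 * b) `^ r)%:E * powG r g2 z)%E.
    rewrite /powG; case: asboolP => Gz; last by rewrite !mule0 adde0.
    rewrite -!EFinM -EFinD lee_fin -!powRM ?mulr_ge0//.
    apply: (@le_trans _ _ ((a * `|g1 z| + b * `|g2 z|) `^ r)).
      by apply: ge0_ler_powR; rewrite ?nnegrE ?(ltW r0) ?addr_ge0 ?mulr_ge0// gle.
    by rewrite -!mulrA; apply: powR_sum_le; rewrite ?mulr_ge0.
  have := @iint_le_linear R n (powG r g) (powG r g1) (powG r g2) _ _ n 0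
    (powR_ge0 (2 * a) r) (powR_ge0 (2 * b) r) (powG_ge0 _ _) l (powG_ge0 _ _) l1
    (powG_ge0 _ _) l2 key.
  have := I0 0; have := I10 0; have := I20 0.
  rewrite -(fineK f) -(fineK f1) -(fineK f2) -!EFinM -EFinD !lee_fin /=.
  move: (fine (iint n (powG r g) 0)) (fine (iint n (powG r g1) 0))
    (fine (iint n (powG r g2) 0)) => I J1 J2 J20 J10 II0 IJ.
  set N1 := J1 `^ r^-1; set N2 := J2 `^ r^-1.
  have N10 : 0 <= N1 by exact: powR_ge0.
  have N20 : 0 <= N2 by exact: powR_ge0.
  apply: ler_powR_root => //; first by rewrite mulr_ge0// addr_ge0// mulr_ge0.
  apply: le_trans IJ _.
  rewrite -(root_powR r0 J10) -(root_powR r0 J20) -/N1 -/N2 -!powRM ?mulr_ge0//.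
  (* [s] dominates both [2 * a * N1] and [2 * b * N2], and the claimed bound is [2 * s]. *)
  set s := 2 * (a * N1 + b * N2).
  have aN : 0 <= a * N1 by rewrite mulr_ge0.
  have bN : 0 <= b * N2 by rewrite mulr_ge0.
  have s0 : 0 <= s by rewrite mulr_ge0// addr_ge0.
  have le1 : (2 * a * N1) `^ r <= s `^ r.
    apply: ge0_ler_powR; rewrite ?nnegrE ?(ltW r0) ?s0 ?mulr_ge0//.
    by rewrite /s -mulrA; lra.
  have le2 : (2 * b * N2) `^ r <= s `^ r.
    apply: ge0_ler_powR; rewrite ?nnegrE ?(ltW r0) ?s0 ?mulr_ge0//.
    by rewrite /s -mulrA; lra.
  have -> : 4 * (a * N1 + b * N2) = 2 * s by rewrite /s; ring.
  rewrite [leRHS]powRM//; apply: le_trans (lerD le1 le2) _.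
  have two : 2 <= (2 : R) `^ r by rewrite -[leLHS]powRr1// ler_powR// ler1n.
  by rewrite -mulr2n -[leLHS]mulr_natl; apply: ler_wpM2r two; exact: powR_ge0.
(* The remaining case is [p = +oo], where the norm is a supremum over [G]. *)
have bdd (h : 'rV[R]_n -> R) : {within closure G, continuous h} -> has_ubound [set `|h z| | z in G].
  move=> ch; have [M M0 hM] := compact_within_bounded (compact_closure_bounded bG) ch.
  by exists M => _ [z Gz <-]; apply/ltW/hM/subset_closure.
have sub (h : 'rV[R]_n -> R) z : {within closure G, continuous h} -> G z ->
    `|h z| <= sup [set `|h z| | z in G].
  by move=> ch Gz; apply: ub_le_sup; [exact: bdd|exists z].
(* For empty [G] all suprema take the default value [0]. *)
have [G0|/set0P[z0 Gz0]] := eqVneq G set0.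
  by rewrite G0 !image_set0 !sup0 !mulr0 addr0 mulr0.
set N1 := sup [set `|g1 z| | z in G]; set N2 := sup [set `|g2 z| | z in G].
have N10 : 0 <= N1 by apply: le_trans (sub g1 z0 cg1 Gz0).
have N20 : 0 <= N2 by apply: le_trans (sub g2 z0 cg2 Gz0).
apply: (@le_trans _ _ (a * N1 + b * N2)); last first.
  have : 0 <= a * N1 + b * N2 by rewrite addr_ge0// mulr_ge0.
  lra.
apply: ge_sup; first by exists `|g z0|; exists z0.
move=> _ [z Gz <-]; apply: le_trans (gle z Gz) _.
by rewrite lerD// ler_wpM2l//; exact: sub.
Qed.

(** Taking all three functions equal in [Lpnorm_le_linear] shows that the norm is at most eight
    times itself, for finite and infinite [p] alike. *)
Lemma Lpnorm_ge0 (p : \bar R) g : (1 <= p)%E ->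
  {within closure G, continuous g} -> 0 <= Lpnorm G p g.
Proof.
move=> p1 cg; have := @Lpnorm_le_linear p g g g 1 1 p1 ler01 ler01 cg cg cg.
have H z : G z -> `|g z| <= 1 * `|g z| + 1 * `|g z| by rewrite mul1r lerDl.
by move=> /(_ H); lra.
Qed.

End LpNorm.

(** * Comparison functions *)

Lemma within_continuous_comp (T U W : topologicalType) (A : set T) (B : set U)
    (h : U -> W) (phi : T -> U) :
  continuous phi -> (forall x, A x -> B (phi x)) ->
  {within B, continuous h} -> {within A, continuous (fun x => h (phi x))}.
Proof.
move=> cphi AB /subspace_continuousP ch; apply/subspace_continuousP => x Ax V hV.
have H : nbhs x [set y | B (phi y) -> V (h (phi y))] :=
  cphi x _ (ch _ (AB x Ax) V hV).
have : nbhs x [set y | A y -> V (h (phi y))].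
  by apply: filterS H => y BV Ay; apply: BV; exact: AB.
exact.
Qed.

Section ComparisonFunctions.
Context {R : realType}.
Implicit Types (g : R -> R) (b : R -> R -> R).

Lemma classK_le g r s : classK g -> 0 <= r -> r <= s -> g r <= g s.
Proof.
move=> [_ _ gm] r0; rewrite le_eqVlt => /predU1P[->//|rs].
exact/ltW/gm.
Qed.

Lemma classK_ge0 g r : classK g -> 0 <= r -> 0 <= g r.
Proof. by move=> gK r0; have [_ g0 _] := gK; rewrite -g0; exact: classK_le. Qed.

(** Continuity from the right at [r]; it allows a gain to be established first for every [c]
    strictly above the norm of the input. *)
Lemma classK_le_right g (x r : R) : classK g -> 0 <= r ->
  (forall c, r < c -> x <= g c) -> x <= g r.
Proof.
move=> [/subspace_continuousP cg _ _] r0 H; apply/ler_addgt0Pr => e e0.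
have /cvgrPdist_lt/(_ e e0) := cg r r0.
move=> /nbhs_ballP[d /= d0 Hd].
have := Hd (r + d / 2); rewrite -ball_normE /= opprD addNKr normrN gtr0_norm ?divr_gt0//.
rewrite ltr_pdivrMr// ltr_pMr// ltr1n => /(_ isT).
have d20 : 0 < d / 2 by rewrite divr_gt0.
move=> /(_ (addr_ge0 r0 (ltW d20))); rewrite ltr_norml => /andP[+ _].
have := H (r + d / 2); rewrite ltrDl => /(_ d20).
rewrite /from_subspace; lra.
Qed.

Lemma classKL_scale b (c d : R) : 0 < c -> 0 < d -> classKL b ->
  classKL (fun r t => c * b (d * r) t).
Proof.
move=> c0 d0 [cb bK bt blim].
have dr (r : R) : 0 <= r -> 0 <= d * r by move=> r0; rewrite mulr_ge0// ltW.
split.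
- move=> q; apply: cvgMr.
  apply: (@within_continuous_comp _ _ _ [set q : R * R | 0 <= q.1 /\ 0 <= q.2]
    [set q : R * R | 0 <= q.1 /\ 0 <= q.2] (fun q => b q.1 q.2)
    (fun q => (d * q.1, q.2))) => //.
    move=> p; have c1 : (fun q : R * R => d * q.1) @ p --> d * p.1.
      by apply: cvgMr; exact: cvg_fst.
    exact: (cvg_pair c1 cvg_snd).
  by move=> p [/= p1 p2]; split => //=; exact: dr.
- move=> t t0; have [ct c00 cm] := bK t t0; split.
  + move=> r; apply: cvgMr.
    apply: (@within_continuous_comp _ _ _ [set r : R | 0 <= r] [set r : R | 0 <= r]
      (fun r => b r t) (fun r => d * r)) => //.
    by move=> p; apply: cvgMr; exact: cvg_id.
  + by rewrite mulr0 c00 mulr0.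
  + by move=> r s r0 rs; rewrite ltr_pM2l// cm ?dr// ltr_pM2l.
- by move=> r r0 t s t0 ts; rewrite ler_pM2l//; apply: bt; rewrite ?dr.
- move=> r r0; rewrite -(mulr0 c); apply: cvgMr; exact: blim (dr r r0).
Qed.

(** The common shape of the gains constructed below. Strict growth comes from [c * g s]; [d] and [e]
    may vanish, as multiples of the norm of [1] do for empty [G]. *)
Lemma classK_combination b g (c d e : R) : 0 < c -> 0 <= d -> 0 <= e ->
  classKL b -> classK g -> classK (fun s => c * b (d * s) 0 + c * g s + e * s).
Proof.
move=> c0 d0 e0 [_ bK _ _] [cg g0 gm].
have b0K := bK 0 (lexx 0); have [cb b00 bm] := b0K.
split.
- move=> r; apply: cvgD; first apply: cvgD.
  + apply: cvgMr.
    apply: (@within_continuous_comp _ _ _ [set r : R | 0 <= r] [set r : R | 0 <= r]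
      (fun r => b r 0) (fun r => d * r)) => //.
      by move=> p; apply: cvgMr; exact: cvg_id.
    by move=> p /= p0; rewrite mulr_ge0.
  + by apply: cvgMr; exact: cg.
  + apply: (@continuous_subspaceT _ _ [set r : R | 0 <= r] (fun r : R => e * r)).
    by move=> p; apply: cvgMr; exact: cvg_id.
- by rewrite !mulr0 b00 g0 !mulr0 !addr0.
- move=> r s r0 rs; apply: ltr_leD; last by rewrite ler_wpM2l// ltW.
  apply: ler_ltD; last by rewrite ltr_pM2l// gm.
  rewrite ler_pM2l//; apply: (classK_le b0K); first by rewrite mulr_ge0.
  by rewrite ler_wpM2l// ltW.
Qed.

(** [z] is at most eight times the larger of [x] and [y]. The term in [y] is frozen at time [0]
    because [y] will be the contribution of the input. *)
Lemma classKL_sum_le b (x y t z : R) : classKL b -> 0 <= x -> 0 <= y -> 0 <= t ->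
  0 <= z -> z <= 4 * (x + y) -> b z t <= b (8 * x) t + b (8 * y) 0.
Proof.
move=> [_ bK bt _] x0 y0 t0 z0 zxy.
have bx : 0 <= b (8 * x) t by apply: (classK_ge0 (bK t t0)); rewrite mulr_ge0.
have by0 : 0 <= b (8 * y) 0 by apply: (classK_ge0 (bK 0 (lexx 0))); rewrite mulr_ge0.
have [xy|yx] := leP x y.
  have : b z t <= b (8 * y) t by apply: (classK_le (bK t t0)) => //; lra.
  have : b (8 * y) t <= b (8 * y) 0 by apply: bt => //; rewrite mulr_ge0.
  lra.
have : b z t <= b (8 * x) t by apply: (classK_le (bK t t0)) => //; lra.
lra.
Qed.

(** For passing between (P) and (Q): [B] and [C] are the current and initial norms in the system
    with the known estimate, [A] and [E] those in the other one. The states differ by a constant of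
    size [s], and [D] is the norm of [1]. *)
Lemma shifted_estimate b g (D A B C E s t : R) : classKL b -> classK g ->
  0 <= D -> 0 <= C -> 0 <= E -> 0 <= s -> 0 <= t ->
  A <= 4 * (B + s * D) -> B <= b C t + g s -> C <= 4 * (E + s * D) ->
  A <= 4 * b (8 * E) t + (4 * b (8 * D * s) 0 + 4 * g s + 4 * D * s).
Proof.
move=> bKL gK D0 C0 E0 s0 t0 AB BC CE.
have sD : 0 <= s * D by rewrite mulr_ge0.
have := classKL_sum_le bKL E0 sD t0 C0 CE.
rewrite -!mulrA [D * s]mulrC; lra.
Qed.

End ComparisonFunctions.

(** * Equivalence of the three properties *)

Section Boundary.
Context {R : realType} {n : nat}.
Implicit Types (G : set 'rV[R]_n) (u x : R -> 'rV[R]_n -> R).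

(** (H3) measures Euclidean distance, whereas the topology of row vectors comes from the maximum
    norm. *)
Lemma norm_le_euclid (v : 'rV[R]_n) : `|v| <= euclid v.
Proof.
rewrite /Num.norm /= mx_normrE; apply/bigmax_leP => /=; split; first exact: sqrtr_ge0.
move=> [i j] _ /=; rewrite ord1 -sqrtr_sqr ler_sqrt.
  by rewrite (bigD1 j)//= lerDl sumr_ge0// => k _; exact: sqr_ge0.
by apply: sumr_ge0 => k _; exact: sqr_ge0.
Qed.

(** Near a point with [|g| < c] continuity suffices; a point with [|g| >= c] is interior, so a
    neighbourhood of it keeps away from the boundary. Compactness makes the width uniform. *)
Lemma boundary_strip G (g : 'rV[R]_n -> R) (c : R) :
  open G -> bounded_set G -> {within closure G, continuous g} ->
  (forall z, bdry G z -> `|g z| < c) ->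
  exists2 delta : R, 0 < delta &
    forall z s, G z -> bdry G s -> euclid (z - s) < delta -> `|g z| <= c.
Proof.
move=> oG bG cg gc.
have /compact_near_coveringP K := compact_closure_bounded bG.
pose P (d : R) (z : 'rV[R]_n) := G z -> forall s, bdry G s -> `|z - s| < d -> `|g z| <= c.
have [|e /= e0 He] := K R (0^'+) P _.
  move=> x Gx; have [gx|gx] := ltP `|g x| c.
    exists ([set y | closure G y -> `|g y| < c], setT) => /=.
      split; last exact: filterT.
      have /subspace_continuousP/(_ x Gx)/(@cvg_norm R R^o) H := cg.
      exact: (cvgr_lt _ H _ gx).
    by move=> [y d] [/= gy _] Gy s _ _; apply/ltW/gy/subset_closure.
  have Gx' : G x.
    by apply: contrapT => nG; move: gx; rewrite leNgt gc.
  have [r r0 rG] := open_norm_ball oG Gx'.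
  (* If [y] is within [r / 2] of [x] and [s] within [r / 2] of [y], then [s] lies in [G] and is no
     boundary point. *)
  have r20 : 0 < r / 2 by rewrite divr_gt0.
  exists (ball x (r / 2), [set d : R | d < r / 2]) => /=.
    split; first exact: nbhsx_ballx.
    exact: nbhs_right_lt.
  move=> [y d] [/= + dr] Gy s [_ nGs] ysd; rewrite -ball_normE /= => xy.
  exfalso; apply: nGs; apply: rG.
  rewrite -(subrKA y) (splitr r) addrC.
  apply: le_lt_trans (ler_normD _ _) _; rewrite addrC; apply: ltrD.
    by rewrite distrC; exact: lt_trans ysd dr.
  by rewrite distrC.
exists (e / 2) => [|z s Gz bs zs]; first by rewrite divr_gt0.
have e20 : 0 < e / 2 by rewrite divr_gt0.
apply: (He (e / 2) _ e20 z (subset_closure Gz) Gz s bs).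
  by rewrite /= sub0r normrN gtr0_norm// ltr_pdivrMr// ltr_pMr// ltr1n.
exact: le_lt_trans (norm_le_euclid _) zs.
Qed.

Lemma normU_ge G u (t : R) z : inU G u -> 0 <= t -> bdry G z -> `|u t z| <= normU G u.
Proof.
move=> [_ _ [M uM]] t0 bz; apply: ub_le_sup; last by exists (t, z).
by exists M => _ [[s y] [/= s0 by_] <-]; exact: uM.
Qed.

Lemma normU_ge0 G u : inU G u -> 0 <= normU G u.
Proof.
move=> uU; have [[z bz]|nb] := pselect (exists z, bdry G z).
  by apply: le_trans (normU_ge uU (lexx 0) bz).
rewrite /normU (_ : [set _ | _ in _] = set0) ?sup0//.
by apply/seteqP; split => // _ [[t z] [/= _ bz] _]; apply: nb; exists z.
Qed.

(** An inequality, because for an empty boundary the supremum is [0]. *)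
Lemma normU_cst_le G (e : R) : normU G (fun _ _ => e) <= `|e|.
Proof.
rewrite /normU; set S := [set _ | _ in _].
have [->|/set0P[y Sy]] := eqVneq S set0; first by rewrite sup0.
by apply: ge_sup; [exists y|move=> _ [q _ <-]].
Qed.

Lemma inU_cst G (e : R) : inU G (fun _ _ => e).
Proof.
split=> [t _|t _ d d0|].
- by move=> z; exact: cvg_cst.
- by exists 1 => // s _ _ z _; rewrite subrr normr0.
- by exists `|e|.
Qed.

Lemma CL_slice G x (t : R) : CL G x -> 0 <= t -> {within closure G, continuous (x t)}.
Proof.
move=> [cx _ _ _ _] t0.
apply: (@within_continuous_comp _ _ _ (closure G)
  [set q : R * 'rV[R]_n | 0 <= q.1 /\ closure G q.2] (fun q => x q.1 q.2)
  (fun z => (t, z))) => //.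
move=> z A [[B1 B2] [/= tB1 zB2] BA].
have : nbhs z [set y | A (t, y)].
  apply: filterS zB2 => y By; apply: (BA (t, y)); split => //=.
  exact: nbhs_singleton tB1.
exact.
Qed.

End Boundary.

Section Equivalence.
Context {R : realType} {n : nat}.
Variables (G : set 'rV[R]_n) (a : 'I_n -> 'I_n -> 'rV[R]_n -> R)
  (f : 'rV[R]_n -> R -> 'rV[R]_n -> R)
  (X : set ('rV[R]_n -> R)) (Uset : ('rV[R]_n -> R) -> set (R -> 'rV[R]_n -> R))
  (p : \bar R).
Hypotheses (st : standing G a f) (h1 : H1 G a f X Uset) (h2 : H2 G f) (h3 : H3 G X)
  (p1 : (1 <= p)%E).

Let oG : open G. Proof. by case: st. Qed.
Let bG : bounded_set G. Proof. by case: st. Qed.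
Let N := Lpnorm G p.
Let D := N (fun _ => 1).

Let X_continuous x : X x -> {within closure G, continuous x}.
Proof. by have [[H _ _ _] _] := h1 => Xx; exact: H. Qed.

Let cst_continuous_within (e : R) :
  {within closure G, continuous (fun _ : 'rV[R]_n => e)}.
Proof. by move=> z; exact: cvg_cst. Qed.

Let D_ge0 : 0 <= D.
Proof. exact: Lpnorm_ge0. Qed.

Let N_shift (g h : 'rV[R]_n -> R) (e : R) :
  {within closure G, continuous g} -> {within closure G, continuous h} ->
  (forall z, G z -> `|g z| <= `|h z| + `|e|) -> N g <= 4 * (N h + `|e| * D).
Proof.
move=> cg ch gh; rewrite -[N h]mul1r; apply: Lpnorm_le_linear => //.
by move=> z Gz; rewrite normr1 mulr1 mul1r; exact: gh.
Qed.

(* The H3 modification of [x0] with boundary value [e]: on the strip where it differs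
   from [x0], [|x0| <= c], so it lies above [x0] for [e = c] and below it for [e = -c]. *)
Let barrier x0 (c e : R) : X x0 -> (forall z, bdry G z -> `|x0 z| < c) ->
  `|e| = c -> exists w0 w (k : 'rV[R]_n -> R),
  [/\ X w0, Uset w0 (fun _ _ => e), isSolP G a f w0 (fun _ _ => e) w,
      (forall z, G z -> 0 <= k z <= 1 /\ w0 z = (1 - k z) * x0 z + e * k z) &
      (forall z, G z -> k z = 0 \/ `|x0 z| <= c)].
Proof.
move=> Xx0 x0c ec; have [[_ _ _ _] H] := h1.
have [d d0 dH] := boundary_strip oG bG (X_continuous Xx0) x0c.
have [k [_ k01 k1 k0 Xw]] := h3 e d0 Xx0.
set w0 := (fun z => _) in Xw.
have [_ _ cst_in sol] := H w0 Xw.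
have Uw : Uset w0 (fun _ _ => e).
  apply: cst_in; first exact: inU_cst.
  by move=> t z _ bz; rewrite /w0 k1// subrr mul0r add0r mulr1.
have [w [wsol _]] := sol _ Uw.
exists w0, w, k; split => //.
  by move=> z Gz; split => //; apply: k01; exact: subset_closure.
move=> z Gz; have [far|near] := pselect (forall s, bdry G s -> d <= euclid (z - s)).
  by left; exact: k0.
right; move/existsNP : near => [s /not_implyP[bs /negP]]; rewrite -ltNge.
exact: dH.
Qed.

(** [w0] is pointwise a convex combination of [x0] and the constant [e]. *)
Let barrier_norm x0 w0 (k : 'rV[R]_n -> R) (c e : R) : X x0 -> X w0 -> `|e| = c ->
  (forall z, G z -> 0 <= k z <= 1 /\ w0 z = (1 - k z) * x0 z + e * k z) ->
  N w0 <= 4 * (N x0 + c * D).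
Proof.
move=> Xx0 Xw0 <- kH; apply: N_shift; try exact: X_continuous.
move=> z /kH[/andP[k0 k1] ->]; apply: le_trans (ler_normD _ _) _.
rewrite !normrM [`|1 - k z|]ger0_norm ?subr_ge0// [`|k z|]ger0_norm//.
apply: lerD; first by rewrite ler_piMl// gerBl.
by rewrite ler_piMr.
Qed.

Lemma ISS_P_of_const : ISS_P_const G a f X Uset p -> ISS_P G a f X Uset p.
Proof.
move=> [b [g [bKL [gK est]]]].
have D80 : 0 <= 8 * D by rewrite mulr_ge0.
(* The outer [8] is the [4] of [Lpnorm_le_linear] times two barriers, the inner one comes from
   [classKL_sum_le]; [0 * s] fits the gain to [classK_combination]. *)
exists (fun r t => 8 * b (8 * r) t).
exists (fun s => 8 * b (8 * D * s) 0 + 8 * g s + 0 * s).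
split; first exact: classKL_scale.
have gK' : classK (fun s => 8 * b (8 * D * s) 0 + 8 * g s + 0 * s).
  exact: classK_combination.
split=> // x0 u x t Xx0 Uu xsol t0.
have [_ /(_ x0 Xx0)[_ /(_ u Uu)[uU u0] _ _]] := h1.
(* The gain is proved at every [c] strictly above the norm of [u]; the strictness is what [barrier]
   asks for on the boundary. *)
rewrite -lerBlDl; apply: (classK_le_right gK'); first exact: normU_ge0.
move=> c uc; have c0 : 0 <= c by apply: le_trans (ltW uc); exact: normU_ge0.
have uc' s z : 0 <= s -> bdry G z -> `|u s z| < c.
  by move=> s0 bz; apply: le_lt_trans uc; exact: normU_ge.
have x0c z : bdry G z -> `|x0 z| < c by move=> bz; rewrite -u0// uc'.
(* One estimate for both barriers, [e = c] and [e = - c]. *)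
have one (e : R) w0 w : `|e| = c -> X w0 -> Uset w0 (fun _ _ => e) ->
    isSolP G a f w0 (fun _ _ => e) w -> N w0 <= 4 * (N x0 + c * D) ->
    N (w t) <= b (8 * N x0) t + b (8 * (c * D)) 0 + g c.
  move=> ec Xw0 Uw wsol Nw0.
  have := est _ _ _ _ Xw0 Uw (ex_intro _ e (fun _ _ _ _ => erefl)) wsol t0.
  have : g (normU G (fun _ _ => e)) <= g c.
    by apply: (classK_le gK); [exact/normU_ge0/inU_cst|rewrite -ec; exact: normU_cst_le].
  have : b (N w0) t <= b (8 * N x0) t + b (8 * (c * D)) 0.
    apply: classKL_sum_le => //; try exact/Lpnorm_ge0/X_continuous.
    by rewrite mulr_ge0.
  rewrite -/N; lra.
have ec1 : `|c| = c by rewrite ger0_norm.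
have ec2 : `|- c| = c by rewrite normrN.
have [v0 [v [k [Xv0 Uv vsol kH kc]]]] := barrier Xx0 x0c ec1.
have [w0 [w [l [Xw0 Uw wsol lH lc]]]] := barrier Xx0 x0c ec2.
have Nv := one c v0 v ec1 Xv0 Uv vsol (barrier_norm Xx0 Xv0 ec1 kH).
have Nw := one (- c) w0 w ec2 Xw0 Uw wsol (barrier_norm Xx0 Xw0 ec2 lH).
have [Cx Lx ix bx] := xsol; have [Cv Lv iv bv] := vsol; have [Cw Lw iw bw] := wsol.
have xv z : closure G z -> x t z <= v t z.
  apply: (comparison_principle st h2 Cx Cv Lx Lv) => // [y Gy|s y s0 By].
    rewrite ix// iv//; have [/andP[k0 k1] ->] := kH y Gy.
    (* Where [k] vanishes the barrier equals [x0]; elsewhere [x0 <= c], and moving towards [c] can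
       only raise it. *)
    have [->|/ler_normlW xc] := kc y Gy; first by rewrite subr0 mul1r mulr0 addr0.
    have : 0 <= k y * (c - x0 y) by rewrite mulr_ge0// subr_ge0.
    lra.
  by rewrite bx// bv//; apply/ltW/(le_lt_trans (ler_norm _))/uc'.
have wx z : closure G z -> w t z <= x t z.
  apply: (comparison_principle st h2 Cw Cx Lw Lx) => // [y Gy|s y s0 By].
    rewrite ix// iw//; have [/andP[l0 l1] ->] := lH y Gy.
    have [->|] := lc y Gy; first by rewrite subr0 mul1r mulr0 addr0.
    rewrite ler_norml => /andP[xc _].
    have : 0 <= l y * (c + x0 y) by rewrite mulr_ge0//; lra.
    lra.
  rewrite bx// bw//; have := uc' s y s0 By.
  by rewrite ltr_norml => /andP[/ltW].
(* [x] lies between [w] and [v], so its absolute value is at most the sum of theirs. *)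
have Nx : N (x t) <= 4 * (1 * N (v t) + 1 * N (w t)).
  apply: Lpnorm_le_linear => //; try exact: CL_slice.
  move=> z Gz; rewrite !mul1r.
  have := xv z (subset_closure Gz); have := wx z (subset_closure Gz).
  have := ler_norm (v t z); have := ler_norm (- w t z); rewrite normrN.
  have := normr_ge0 (v t z); have := normr_ge0 (w t z).
  by move=> A1 A2 A3 A4 A5 A6; rewrite ler_norml; apply/andP; split; lra.
rewrite -[X in _ - X]/(8 * b (8 * N x0) t) -/N mul0r addr0.
rewrite -mulrA [D * c]mulrC; lra.
Qed.

(** The solution [x] underlying (Q) solves (P) from [y + k] with input [k]; only the norms are moved
    by [k], initially and at time [t]. *)
Lemma ISS_Q_of_const : ISS_P_const G a f X Uset p -> ISS_Q G a f X p.
Proof.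
move=> [b [g [bKL [gK est]]]].
have D80 : 0 <= 8 * D by rewrite mulr_ge0.
have D40 : 0 <= 4 * D by rewrite mulr_ge0.
exists (fun r t => 4 * b (8 * r) t).
exists (fun s => 4 * b (8 * D * s) 0 + 4 * g s + 4 * D * s).
split; first exact: classKL_scale.
split; first exact: classK_combination.
move=> y k x t Xy y0 xsol t0.
have [[_ Xc Xadd _] H] := h1.
have Xyk : X (fun z => y z + k) by exact: Xadd.
have [_ _ cst_in _] := H _ Xyk.
have Uk : Uset (fun z => y z + k) (fun _ _ => k).
  by apply: cst_in; [exact: inU_cst|move=> s z _ bz; rewrite y0// add0r].
have Cx : CL G x by case: xsol.
have cx := CL_slice Cx t0.
have cxk : {within closure G, continuous (fun z => x t z - k)}.
  by move=> z; apply: cvgB; [exact: cx|exact: cvg_cst].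
have E := est _ _ _ _ Xyk Uk (ex_intro _ k (fun _ _ _ _ => erefl)) xsol t0.
apply: (@shifted_estimate _ b g D _ (N (x t)) (N (fun z => y z + k))) => //.
- exact/Lpnorm_ge0/X_continuous.
- exact/Lpnorm_ge0/X_continuous.
- by apply: N_shift => // z _; exact: ler_normB.
- apply: le_trans E _; rewrite lerD2l; apply: (classK_le gK); last exact: normU_cst_le.
  exact/normU_ge0/inU_cst.
- by apply: N_shift => [||z _]; [exact: X_continuous|exact: X_continuous|exact: ler_normD].
Qed.

(** Subtracting the constant boundary value [k] from [x0] gives a state of (Q) to which the estimate
    applies. *)
Lemma ISS_const_of_Q : ISS_Q G a f X p -> ISS_P_const G a f X Uset p.
Proof.
move=> [b [g [bKL [gK est]]]].
have D80 : 0 <= 8 * D by rewrite mulr_ge0.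
have D40 : 0 <= 4 * D by rewrite mulr_ge0.
have gK' : classK (fun s => 4 * b (8 * D * s) 0 + 4 * g s + 4 * D * s).
  exact: classK_combination.
exists (fun r t => 4 * b (8 * r) t).
exists (fun s => 4 * b (8 * D * s) 0 + 4 * g s + 4 * D * s).
split; first exact: classKL_scale.
split=> // x0 u x t Xx0 Uu [k0 uk0] xsol t0.
have [[_ Xc Xadd _] H] := h1.
have [_ /(_ u Uu)[uU u0] _ _] := H x0 Xx0.
(* With an empty boundary every [k] is a boundary value of [u]; [0] is bounded by [normU]. *)
have [k uk kU] : exists2 k, (forall s z, 0 <= s -> bdry G z -> u s z = k) & `|k| <= normU G u.
  have [[z bz]|nb] := pselect (exists z, bdry G z).
    by exists k0 => //; rewrite -(uk0 0 z (lexx 0) bz); exact: normU_ge.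
  exists 0; last by rewrite normr0; exact: normU_ge0.
  by move=> s z _ bz; exfalso; apply: nb; exists z.
have [Cx Lx ix bx] := xsol.
have Xy : X (fun z => x0 z + - k) by exact: Xadd.
have y0 z : bdry G z -> x0 z + - k = 0.
  by move=> bz; rewrite -u0// uk// subrr.
have ysol : isSolP G a f (fun z => x0 z + - k + k) (fun _ _ => k) x.
  split => // [z Gz|s z s0 bz]; first by rewrite subrK ix.
  by rewrite bx// uk.
have cx := CL_slice Cx t0.
have cxk : {within closure G, continuous (fun z => x t z - k)}.
  by move=> z; apply: cvgB; [exact: cx|exact: cvg_cst].
have E := est _ _ _ _ Xy y0 ysol t0.
(* The gain first appears at [|k|] and is raised to [normU G u] by monotonicity. *)
apply: (@le_trans _ _ (4 * b (8 * N x0) t +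
    (4 * b (8 * D * `|k|) 0 + 4 * g `|k| + 4 * D * `|k|))); last first.
  by rewrite lerD2l; exact: (classK_le gK').
apply: (@shifted_estimate _ b g D _ (N (fun z => x t z - k)) (N (fun z => x0 z + - k))) => //.
- exact/Lpnorm_ge0/X_continuous.
- exact/Lpnorm_ge0/X_continuous.
- by apply: N_shift => // z _; rewrite -{1}(subrK k (x t z)); exact: ler_normD.
- by apply: N_shift => [||z _]; [exact: X_continuous|exact: X_continuous|exact: ler_normB].
Qed.

End Equivalence.

Theorem mainTheorem5 (R : realType) (n : nat) (G : set 'rV[R]_n)
  (a : 'I_n -> 'I_n -> 'rV[R]_n -> R) (f : 'rV[R]_n -> R -> 'rV[R]_n -> R)
  (X : set ('rV[R]_n -> R)) (Uset : ('rV[R]_n -> R) -> set (R -> 'rV[R]_n -> R))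
  (p : \bar R) :
  standing G a f ->
  uniqueP G a f X Uset ->
  H1 G a f X Uset -> H2 G f -> H3 G X ->
  (1 <= p)%E ->
  (ISS_P G a f X Uset p <-> ISS_P_const G a f X Uset p) /\
  (ISS_P_const G a f X Uset p <-> ISS_Q G a f X p).
Proof.
move=> st _ h1 h2 h3 p1; split; split.
- move=> [b [g [bKL [gK est]]]]; exists b, g; split=> //; split=> // x0 u x t Xx0 Uu _.
  exact: est.
- exact: ISS_P_of_const.
- exact: ISS_Q_of_const.
- exact: ISS_const_of_Q.
Qed.
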